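(* There exist two sequences of index sets $(\Lambda^u_N)_{N\ge1}$ and $(\Lambda^p_N)_{N\ge1}$, each $\Lambda_N^u,\Lambda_N^p\subset\mathcal F$ consisting of $N$ indices $\nu\in\mathcal F$ corresponding to the $N$ largest Taylor coefficients $\|t^u_\nu\|_{\mathcal V}$ and $\|t^p_\nu\|_{\mathcal Q}$, respectively, such that, with $r(\sigma)=\frac1\sigma-1$ for $\sigma<1$: (i) if $(\|\kappa_j\|_{\mathcal K})_{j\ge1}\in\ell^s(\mathbb N)$ for some $s\in(0,1)$, then $$\sup_{y\in U}\|u(y)-T_{\Lambda^u_N}u(y)\|_{\mathcal V}\le\big\|(\|t^u_\nu\|_{\mathcal V})_{\nu\in\mathcal F}\big\|_{\ell^s(\mathcal F)}N^{-r(s)},\qquad \sup_{y\in U}\|p(y)-T_{\Lambda^p_N}p(y)\|_{\mathcal Q}\le\big\|(\|t^p_\nu\|_{\mathcal Q})_{\nu\in\mathcal F}\big\|_{\ell^s(\mathcal F)}N^{-r(s)};$$ (ii) if there exist a sequence $(\rho_j)_{j\ge1}$ with $\rho_j>1$ and $\epsilon$ with $\theta<\epsilon<\kappa_{\min}$ such that $\sum_{j\ge1}\rho_j|\kappa_j(x)|\le\kappa_0(x)-\epsilon$ for all $x\in D$ and $(\rho_j^{-1})_{j\ge1}\in\ell^t(\mathbb N)$ for some $t\in(0,\infty)$, then with $s=\frac{2t}{2+t}$, $$\sup_{y\in U}\|u(y)-T_{\Lambda^u_N}u(y)\|_{\mathcal V}\le\big\|(\|t^u_\nu\|_{\mathcal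 V})_{\nu\in\mathcal F}\big\|_{\ell^s(\mathcal F)}N^{-r(s)}\quad\text{when } s<1,$$ $$\sup_{y\in U}\|p(y)-T_{\Lambda^p_N}p(y)\|_{\mathcal Q}\le\big\|(\|t^p_\nu\|_{\mathcal Q})_{\nu\in\mathcal F}\big\|_{\ell^t(\mathcal F)}N^{-r(t)}\quad\text{when } t<1.$$
   Context: Spaces and forms. $D\subset\mathbb{R}^d$ is an open bounded domain; $\mathcal V,\mathcal Q$ are real Hilbert spaces with duals $\mathcal V',\mathcal Q'$; $f\in\mathcal V'$, $g\in\mathcal Q'$. $\mathcal K$ is a separable Banach space of real-valued essentially bounded functions on $D$ with $\operatorname{ess\,sup}_D|\kappa|\le\|\kappa\|_{\mathcal K}$. $b:\mathcal V\times\mathcal Q\to\mathbb R$ is bilinear, and $a(w,v;\kappa)=a_0(w,v)+a_1(w,v;\kappa)$ for $\kappa\in L^\infty(D)$, where $a_0$ and $a_1(\cdot,\cdot;\kappa)$ are bilinear on $\mathcal V\times\mathcal V$ and $a_1$ is linear in $\kappa$. Let $\mathcal V^0=\{v\in\mathcal V: b(v,q)=0\ \forall q\in\mathcal Q\}$. There are constants $c_1,C_1>0$, independent of $\kappa$, with: $a_1(v,v;\kappa)\ge c_1\operatorname{ess\,inf}_D\kappa\,\|v\|_{\mathcal V}^2$ for $v\in\mathcal V^0$ and $\kappa\ge0$; $a_1(w,v;\kappa)\le C_1\operatorname{ess\,sup}_D|\kappa|\,\|w\|_{\mathcal V}\|v\|_{\mathcal V}$ for all $w,v\in\mathcal V$;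 $a_1(w,v;\kappa)\le\frac12\big(a_1(w,w;|\kappa|)+a_1(v,v;|\kappa|)\big)$ for all $w,v\in\mathcal V$. Saddle point problem at $\kappa$: find $(u,p)\in\mathcal V\times\mathcal Q$ such that $a(u,v;\kappa)+b(v,p)=f(v)$ for all $v\in\mathcal V$ and $b(u,q)=g(q)$ for all $q\in\mathcal Q$. Well-posedness assumptions. There are $0<\theta<\Theta<\infty$ and constants $\gamma,\delta,\alpha,\beta>0$ such that for every $\kappa$ with $\theta\le\kappa(x)\le\Theta$ on $D$: $a(w,v;\kappa)\le\gamma\|w\|_{\mathcal V}\|v\|_{\mathcal V}$ for all $w,v\in\mathcal V$; $a(v,v;\kappa)\ge\alpha\|v\|_{\mathcal V}^2$ for all $v\in\mathcal V^0$; moreover $b(v,q)\le\delta\|v\|_{\mathcal V}\|q\|_{\mathcal Q}$ and $\inf_{q\in\mathcal Q}\sup_{v\in\mathcal V}\frac{b(v,q)}{\|v\|_{\mathcal V}\|q\|_{\mathcal Q}}\ge\beta$. Under these assumptions the problem has a unique solution. Affine parametrization. $U=[-1,1]^{\mathbb N}$, $\kappa(x,y)=\kappa_0(x)+\sum_{j\ge1}y_j\kappa_j(x)$ for $(x,y)\in D\times U$, with $\kappa_j\in\mathcal K$ for $j\ge0$, and $\theta<\kappa_{\min}:=\inf_{D\times U}\kappa\le\sup_{D\times U}\kappa=:\kappa_{\max}<\Theta/2$. $(u(y),p(y))$ denotes the solution at $\kappa=\kappa(\cdot,y)$. Taylor approximation. $\mathcal F$ is the set of finitely supported sequences $\nu=(\nu_j)_{j\ge1}$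 of nonnegative integers; $\nu!=\prod_j\nu_j!$; $y^\nu=\prod_jy_j^{\nu_j}$ with $0^0=1$; for $\psi=u,p$, $t^\psi_\nu=\frac1{\nu!}\partial^\nu\psi(0)$, where $\partial^\nu$ is the mixed partial derivative in $y$ of order $\nu$; for finite $\Lambda\subset\mathcal F$, $T_\Lambda\psi(y)=\sum_{\nu\in\Lambda}t^\psi_\nu y^\nu$. $\|(\theta_\nu)\|_{\ell^s(\mathcal F)}=\big(\sum_{\nu\in\mathcal F}|\theta_\nu|^s\big)^{1/s}$, which is understood to be finite in the estimates. *)

(* Defs.v *)
From HB Require Import structures.
From mathcomp Require Import all_boot all_order all_algebra finmap.
From mathcomp Require Import all_classical all_reals all_analysis ess_sup_inf.

Set Implicit Arguments.
Unset Strict Implicit.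
Unset Printing Implicit Defensive.

Import Order.TTheory GRing.Theory Num.Theory.
Import numFieldNormedType.Exports.

Local Open Scope classical_set_scope.
Local Open Scope ring_scope.

Section lebesgue_tuple.
Context {R : realType}.
Local Notation mR := (measurableTypeR R).

Definition tuple_cons n (xt : mR * n.-tuple mR) : n.+1.-tuple mR :=
  [tuple of xt.1 :: xt.2].

Definition tuple_uncons n (t : n.+1.-tuple mR) : mR * n.-tuple mR :=
  (thead t, [tuple of behead t]).

Lemma measurable_tuple_cons n : measurable_fun setT (@tuple_cons n).
Proof.
by apply: measurable_cons; [exact: measurable_fst|exact: measurable_snd].
Qed.

Lemma measurable_tuple_uncons n : measurable_fun setT (@tuple_uncons n).
Proof.
apply: measurable_fun_pair.
  exact: measurable_tnth.
exact: measurable_behead.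
Qed.

Lemma tuple_consK n : cancel (@tuple_cons n) (@tuple_uncons n).
Proof. by case=> x t; congr pair; apply: val_inj. Qed.

Section step.
Variables (n : nat) (m : {sigma_finite_measure set (n.-tuple mR) -> \bar R}).

Definition lebesgue_tuple_step : set (n.+1.-tuple mR) -> \bar R :=
  pushforward (@lebesgue_measure R \x m)%E (@tuple_cons n).

Let step0 : lebesgue_tuple_step set0 = 0%E.
Proof. by rewrite /lebesgue_tuple_step /pushforward preimage_set0 measure0. Qed.

Let step_ge0 A : (0 <= lebesgue_tuple_step A)%E.
Proof. exact: (measure_ge0 (@lebesgue_measure R \x m)%E). Qed.

Let step_sigma_additive : semi_sigma_additive lebesgue_tuple_step.
Proof.
pose mc : {measure set _ -> \bar R} :=
  measure_function_pushforward__canonical__measure_function_Measure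
    (@lebesgue_measure R \x m)%E (@measurable_tuple_cons n).
exact: (@measure_semi_sigma_additive _ _ _ mc).
Qed.

HB.instance Definition _ := isMeasure.Build _ _ _ lebesgue_tuple_step
  step0 step_ge0 step_sigma_additive.

Let step_sigma_finite : sigma_finite setT lebesgue_tuple_step.
Proof.
have /sigma_finiteP[F [TF ndF Foo]] := sigma_finiteT (@lebesgue_measure R).
have /sigma_finiteP[G [TG ndG Goo]] := sigma_finiteT m.
exists (fun k => @tuple_uncons n @^-1` (F k `*` G k)).
  apply/seteqP; split=> // t _.
  have [i _ Fi] : (\bigcup_i F i) (tuple_uncons t).1 by rewrite -TF.
  have [j _ Gj] : (\bigcup_i G i) (tuple_uncons t).2 by rewrite -TG.
  exists (maxn i j) => //; split.
    by move: Fi; exact/subsetPset/ndF/leq_maxl.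
  by move: Gj; exact/subsetPset/ndG/leq_maxr.
move=> k; have [mF Fk] := Foo k; have [mG Gk] := Goo k; split.
  rewrite -[X in measurable X]setTI; apply: measurable_tuple_uncons => //.
  exact: measurableX.
rewrite /lebesgue_tuple_step /pushforward -comp_preimage.
rewrite (_ : _ \o _ = id); last by apply/funext => x; exact: tuple_consK.
by rewrite product_measure1E// lte_mul_pinfty// ge0_fin_numE.
Qed.

HB.instance Definition _ := @Measure_isSigmaFinite.Build _ _ _
  lebesgue_tuple_step step_sigma_finite.

End step.

(* The Lebesgue measure on R^n is the n-fold product of the one on R. *)
Fixpoint lebesgue_tuple n : {sigma_finite_measure set (n.-tuple mR) -> \bar R} :=
  match n return {sigma_finite_measure set (n.-tuple mR) -> \bar R} with
  | 0 => \d_ [tuple]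
  | n'.+1 => lebesgue_tuple_step (lebesgue_tuple n')
  end.

End lebesgue_tuple.

Definition borel_rV (R : realType) (d : nat) :=
  g_sigma_algebraType (@open 'rV[R]_d).

Lemma measurable_open_rV (R : realType) (d : nat) (D : set 'rV[R]_d) :
  open D -> measurable (D : set (borel_rV R d)).
Proof. by move=> oD; apply: sub_sigma_algebra. Qed.

Section lebesgue_rV.
Context {R : realType} {d : nat}.
Local Notation mR := (measurableTypeR R).

Definition row_of_tuple (t : d.-tuple mR) : borel_rV R d := \row_i tnth t i.

Let rat_ball (qr : 'rV[rat]_d * rat) : set 'rV[R]_d :=
  ball (map_mx ratr qr.1 : 'rV[R]_d) (ratr qr.2 : R).

Let open_rat_balls (D : set 'rV[R]_d) : open D ->
  D = \bigcup_(qr in [set qr | rat_ball qr `<=` D]) rat_ball qr.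
Proof.
move=> oD; apply/seteqP; split; last by move=> x [qr /= qrD qrx]; exact: qrD.
move=> x Dx.
have /nbhs_ballP[_/posnumP[e] eD] : nbhs x D by move: oD; rewrite openE; exact.
have [r r0 re] : exists2 r : rat, (0 < ratr r :> R) & (ratr r < e%:num / 2).
  have [r] := rat_in_itvoo (divr_gt0 [gt0 of e%:num] (ltr0n R 2)).
  by rewrite in_itv /= => /andP[]; exists r.
have q_ex i : exists q : rat, `|ratr q - x ord0 i| < ratr r.
  have /rat_in_itvoo[q] : x ord0 i - ratr r < x ord0 i + ratr r.
    by rewrite ltrBlDr -addrA ltrDl addr_gt0.
  by rewrite in_itv /= -ltr_distl; exists q.
have [q qP] := choice q_ex.
have qx : rat_ball (\row_i q i, r) x.
  split=> // i j; rewrite ord1 !mxE -ball_normE /=; exact: qP.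
exists (\row_i q i, r) => //= y qy; apply: eD.
rewrite [e%:num]splitr.
apply: (@ball_triangle _ 'rV[R]_d (map_mx ratr (\row_i q i))).
  by apply: (le_ball (ltW re)); exact/ball_sym.
exact: (le_ball (ltW re)).
Qed.

Lemma measurable_row_of_tuple : measurable_fun setT row_of_tuple.
Proof.
apply: (@measurability _ _ _ (borel_rV R d) _ _ (@open 'rV[R]_d)) => //.
move=> _ [D oD <-]; rewrite setTI (open_rat_balls oD) preimage_bigcup.
rewrite bigcup_mkcond; apply: countable_bigcupT_measurable => [|qr].
  exact: countableP.
case: ifP => // _.
have [r0|r0] := ltP 0 (ratr qr.2 : R); last first.
  rewrite (_ : _ @^-1` _ = set0)//; apply/seteqP; split=> // t [].
  by rewrite ltNge r0.
rewrite (_ : _ @^-1` _ = \bigcap_(i in [set: 'I_d])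
    (fun t : d.-tuple mR => tnth t i) @^-1`
      (ball (ratr (qr.1 ord0 i) : R) (ratr qr.2))); last first.
  apply/seteqP; split=> t /=.
    by move=> [_ tb] i _; have := tb ord0 i; rewrite !mxE.
  by move=> tb; split=> // i j; rewrite ord1 !mxE; exact: tb.
apply: fin_bigcap_measurable => // i _.
rewrite -[X in measurable X]setTI; apply: measurable_tnth => //.
by rewrite ball_itv; exact: measurable_itv.
Qed.

Definition lebesgue_rV : set (borel_rV R d) -> \bar R :=
  pushforward (@lebesgue_tuple R d) row_of_tuple.

Let lebesgue_rV0 : lebesgue_rV set0 = 0%E.
Proof. by rewrite /lebesgue_rV /pushforward preimage_set0 measure0. Qed.

Let lebesgue_rV_ge0 A : (0 <= lebesgue_rV A)%E.
Proof. exact: (measure_ge0 (@lebesgue_tuple R d)). Qed.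

Let lebesgue_rV_sigma_additive : semi_sigma_additive lebesgue_rV.
Proof.
pose mc : {measure set _ -> \bar R} :=
  measure_function_pushforward__canonical__measure_function_Measure
    (@lebesgue_tuple R d) measurable_row_of_tuple.
exact: (@measure_semi_sigma_additive _ _ _ mc).
Qed.

HB.instance Definition _ := isMeasure.Build _ _ _ lebesgue_rV
  lebesgue_rV0 lebesgue_rV_ge0 lebesgue_rV_sigma_additive.

End lebesgue_rV.

Definition hilbert_space (R : realType) (V : completeNormedModType R) : Prop :=
  exists ip : {biscalar V},
    (forall w v, ip w v = ip v w) /\ (forall v, ip v v = `|v| ^+ 2).

Definition separable (T : topologicalType) : Prop :=
  exists2 S : set T, countable S & dense S.

Section Linfty.
Context {R : realType} {d : nat} {D : set 'rV[R]_d} (oD : open D).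

Definition lebesgue_on : {measure set (borel_rV R d) -> \bar R} :=
  mrestr (@lebesgue_rV R d) (measurable_open_rV oD).

(* Elements are functions on R^d rather than on D: their values outside D are
   irrelevant. *)
Definition Linfty (k : 'rV[R]_d -> R) : Prop :=
  measurable_fun (D : set (borel_rV R d)) (k : borel_rV R d -> R) /\
  (ess_sup lebesgue_on (fun x => `|k x|%:E) < +oo)%E.

(* [ev] sends an element of K to a representative of the (class of) functions
   it stands for, so it is only required to be linear almost everywhere. *)
Record function_space (K : completeNormedModType R)
    (ev : K -> 'rV[R]_d -> R) : Prop := {
  function_space_linear : forall c k l,
    \forall x \ae lebesgue_on, ev (c *: k + l) x = c * ev k x + ev l x;
  function_space_inj : forall k l, (forall x, D x -> ev k x = ev l x) -> k = l;
  function_space_Linfty : forall k, Linfty (ev k);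
  function_space_norm : forall k,
    (ess_sup lebesgue_on (fun x => `|ev k x|%:E) <= `|k|%:E)%E }.

End Linfty.

Section saddle_point.
Context {R : realType} {d : nat} {D : set 'rV[R]_d} (oD : open D).
Context {V Q : completeNormedModType R}.
Variables (b : {bilinear V -> Q -> R | *%R & *%R}) (a0 : {biscalar V}).
Variable a1 : V -> V -> ('rV[R]_d -> R) -> R.

Definition form_kernel : set V := [set v | forall q, b v q = 0].

Definition form_a (w v : V) (k : 'rV[R]_d -> R) : R := a0 w v + a1 w v k.

Record form_a1_assumptions (c1 C1 : R) : Prop := {
  a1_linearl : forall k, Linfty oD k -> forall c w w' v,
    a1 (c *: w + w') v k = c * a1 w v k + a1 w' v k;
  a1_linearr : forall k, Linfty oD k -> forall c w v v',
    a1 w (c *: v + v') k = c * a1 w v k + a1 w v' k;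
  a1_linear_coef : forall k l, Linfty oD k -> Linfty oD l -> forall c w v,
    a1 w v (fun x => c * k x + l x) = c * a1 w v k + a1 w v l;
  a1_coercive : forall k, Linfty oD k -> (forall x, D x -> 0 <= k x) ->
    forall v, form_kernel v ->
    (c1%:E * ess_inf (lebesgue_on oD) (fun x => (k x)%:E) * (`|v| ^+ 2)%:E
     <= (a1 v v k)%:E)%E;
  a1_bounded : forall k, Linfty oD k -> forall w v,
    ((a1 w v k)%:E <= C1%:E *
      ess_sup (lebesgue_on oD) (fun x => `|k x|%:E) * (`|w| * `|v|)%:E)%E;
  a1_young : forall k, Linfty oD k -> forall w v,
    a1 w v k <=
      2^-1 * (a1 w w (fun x => `|k x|) + a1 v v (fun x => `|k x|)) }.

Record well_posedness (theta Theta gamma delta alpha beta : R) : Prop := {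
  form_a_bounded : forall k, Linfty oD k ->
    (forall x, D x -> theta <= k x <= Theta) ->
    forall w v, form_a w v k <= gamma * `|w| * `|v|;
  form_a_coercive : forall k, Linfty oD k ->
    (forall x, D x -> theta <= k x <= Theta) ->
    forall v, form_kernel v -> alpha * `|v| ^+ 2 <= form_a v v k;
  form_b_bounded : forall v q, b v q <= delta * `|v| * `|q|;
  form_b_inf_sup : (beta%:E <= ereal_inf
    [set ereal_sup [set (b v q / (`|v| * `|q|))%:E | v in [set v : V | v != 0%R]]
      | q in [set q : Q | q != 0%R]])%E }.

Definition saddle_point_solution (f : {scalar V}) (g : {scalar Q})
    (k : 'rV[R]_d -> R) (u : V) (p : Q) : Prop :=
  (forall v, form_a u v k + b v p = f v) /\ (forall q, b u q = g q).

End saddle_point.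

(* Sequences indexed by j >= 1 are shifted: [y j] is y_{j+1}, and it multiplies
   [k j.+1]. *)
Section affine.
Context {R : realType}.

Definition cube : set (nat -> R) := [set y | forall j, -1 <= y j <= 1].

Context {d : nat} (D : set 'rV[R]_d) (k : nat -> 'rV[R]_d -> R).

Definition affine_converges : Prop := forall x y, D x -> cube y ->
  cvgn (series (fun j => y j * k j.+1 x)).

Definition affine (y : nat -> R) (x : 'rV[R]_d) : R :=
  k 0 x + limn (series (fun j => y j * k j.+1 x)).

Definition affine_min : \bar R :=
  ereal_inf [set (affine y x)%:E | x in D & y in cube].

Definition affine_max : \bar R :=
  ereal_sup [set (affine y x)%:E | x in D & y in cube].

End affine.

Notation multi_index := {fsfun nat -> nat with 0%N}.

Section taylor.
Context {R : realType}.
Implicit Types (nu : multi_index) (y : nat -> R).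

Definition multi_fact nu : nat := (\prod_(j <- finsupp nu) (nu j)`!)%N.

Definition multi_pow y nu : R := \prod_(j <- finsupp nu) y j ^+ nu j.

Context {W : normedModType R}.
Implicit Type psi : (nat -> R) -> W.

Definition partial (j : nat) psi : (nat -> R) -> W :=
  fun y => derive1 (fun h : R => psi [eta y with j |-> h]) (y j).

(* The one-variable derivatives are taken in the order in which [finsupp nu] is
   enumerated; they commute for the maps of interest. *)
Definition mixed_partial nu psi : (nat -> R) -> W :=
  foldr (fun j => iter (nu j) (partial j)) psi (finsupp nu).

Definition taylor_coef psi nu : W :=
  (multi_fact nu)%:R^-1 *: mixed_partial nu psi (fun=> 0).

Definition taylor_sum (Lambda : {fset multi_index}) psi y : W :=
  \sum_(nu <- Lambda) multi_pow y nu *: taylor_coef psi nu.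

Definition largest_coefs (N : nat) psi (Lambda : {fset multi_index}) : Prop :=
  #|` Lambda| = N /\
  forall nu mu, nu \in Lambda -> mu \notin Lambda ->
    `|taylor_coef psi mu| <= `|taylor_coef psi nu|.

End taylor.

Section estimate.
Context {R : realType}.

Definition lnorm {I : choiceType} (s : R) (th : I -> R) : \bar R :=
  ((\esum_(i in [set: I]) (`|th i| `^ s)%:E) `^ s^-1)%E.

Definition in_ell {I : choiceType} (s : R) (th : I -> R) : Prop :=
  (lnorm s th < +oo)%E.

Definition rate (s : R) : R := s^-1 - 1.

Definition taylor_estimate {W : normedModType R} (psi : (nat -> R) -> W)
    (Lambda : nat -> {fset multi_index}) (s : R) : Prop :=
  in_ell s (fun nu => `|taylor_coef psi nu|) /\
  forall N, (0 < N)%N ->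
  (ereal_sup [set `|psi y - taylor_sum (Lambda N) psi y|%:E | y in cube]
   <= lnorm s (fun nu => `|taylor_coef psi nu|%R)
      * (N%:R `^ (- rate s))%:E)%E.

End estimate.

(* Main.v *)
Require Import Defs.
From HB Require Import structures.
From mathcomp Require Import all_boot all_order all_algebra finmap.
From mathcomp Require Import all_classical all_reals all_analysis.
From mathcomp Require Import ess_sup_inf measurable_realfun.
From mathcomp Require Import ring lra zify.

Import Order.TTheory GRing.Theory Num.Theory.
Import numFieldNormedType.Exports.

Local Open Scope classical_set_scope.
Local Open Scope ring_scope.

(* The Taylor coefficients of (u, p) at 0 satisfy
     a(t_nu, v; kappa_0) + b(v, tp_nu) = - sum_{j in supp nu} a1(t_(nu - e_j), v; kappa_j),
     b(t_nu, q) = 0                                                  (nu <> 0),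
   obtained by differentiating the saddle point problem.  Let rho_j >= 0 with
   sum_j rho_j |kappa_j| <= kappa_0 - eps almost everywhere, and put
   T_nu = rho^nu t_nu and d(v) = a1(v, v; kappa_0 - eps).  Testing with v = T_nu and
   Young's inequality for a1 give, for nu <> 0,
     alpha |T_nu|^2 + d(T_nu)/2
       <= 1/2 sum_{j in supp nu} rho_j a1(T_(nu - e_j), T_(nu - e_j); |kappa_j|),
   and summing over a downward closed set of indices, where the right-hand side adds up
   to at most 1/2 sum_mu d(T_mu), the d-terms cancel except at nu = 0.  Hence
   sum_nu rho^(2 nu) |t_nu|^2 is bounded by a constant that does not depend on rho, and
   the inf-sup condition transfers this bound to tp_nu.

   With rho = 1 this makes the sets of N largest coefficients exist.  In (ii) it is
   combined with sum_nu rho^(-t nu) < oo by Young's inequality.  In (i) one applies it to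
   a weight rho that depends on nu, as in the work of Cohen, DeVore and Schwab, but with
   no recourse to complex analysis.  In both cases the Taylor series then converges
   to (u, p), because the residual of its partial sums in the saddle point problem tends
   to 0, and the rate is Stechkin's inequality. *)

(** * Multi-indices *)

(** In (i) the weight may depend on nu only because the bound on sum_nu rho^(2 nu) |t_nu|^2 is the
    same for all admissible rho. It rests on the splitting kappa_0 = eps + (kappa_0 - eps): the
    constant coefficient eps lies in [theta, Theta] and supplies alpha |v|^2, while kappa_0 - eps
    absorbs the energy that Young's inequality passes from one index to the next. Lowering eps a
    little leaves a margin eta for raising rho above 1. For given nu, half of it is spent on the
    variables of large index, in proportion to nu_j. Elementary bounds on factorials then turn
    rho^(-nu) into a multinomial weight (n! / nu!) d^nu with d_j comparable to the norm of kappa_j,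
    which obeys a one-step recursion in nu; the finitely many remaining variables contribute
    geometric decay. The derivatives need care: nothing is assumed on the regularity of y |-> (u(y),
    p(y)), and a limit of difference quotients means something only once they converge. Convergence,
    the differentiated systems and the symmetry of mixed derivatives all come from one stability
    estimate. *)

Section multi_index.
Implicit Types nu mu : multi_index.

(* nu - e_j, truncated to nu when nu_j = 0. *)
Definition mdec nu j : multi_index := [fsfun nu with j |-> (nu j).-1].

Lemma mdecE nu j i : mdec nu j i = if i == j then (nu j).-1 else nu i.
Proof. exact: fsfun_withE. Qed.

Definition minc nu j : multi_index := [fsfun nu with j |-> (nu j).+1].

Lemma mincE nu j i : minc nu j i = if i == j then (nu j).+1 else nu i.
Proof. exact: fsfun_withE. Qed.

Lemma mincK nu j : mdec (minc nu j) j = nu.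
Proof. by apply/fsfunP => i; rewrite mdecE !mincE eqxx; case: eqP => [->|]. Qed.

Lemma mdecK nu j : (0 < nu j)%N -> minc (mdec nu j) j = nu.
Proof.
move=> nuj; apply/fsfunP => i; rewrite mincE !mdecE eqxx prednK//.
by case: eqP => [->|].
Qed.

Lemma fsfun0 j : ([fsfun] : multi_index) j = 0%N.
Proof. exact: fsfun0E. Qed.

Lemma finsupp_gt0 nu j : (j \in finsupp nu) = (0 < nu j)%N.
Proof. by rewrite mem_finsupp lt0n. Qed.

Lemma multi_index_neq0 nu : nu != [fsfun] -> exists j, (0 < nu j)%N.
Proof.
move=> nu0; apply: contrapT => /forallNP nu_eq0.
move/eqP: nu0; apply; apply/fsfunP => j; rewrite fsfun0.
by apply/eqP; rewrite -leqn0 leqNgt; apply/negP/nu_eq0.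
Qed.

(** Boxes are stable under [mdec] and cofinal among finite sets, so they exhaust all multi-indices
    by sets on which a recursion in nu closes up. *)
Definition mbox J n : {fset multi_index} :=
  fset_set [set nu : multi_index | forall j, (nu j <= if (j < J)%N then n else 0)%N].

(** [fset_set] is meaningful only for finite sets, so the content is finiteness: the box is covered
    by the image of a finite function type. *)
Lemma mem_mbox J n nu : nu \in mbox J n <->
  forall j, (nu j <= if (j < J)%N then n else 0)%N.
Proof.
rewrite /mbox in_fset_set ?inE//.
pose h (F : {ffun 'I_J -> 'I_n.+1}) : multi_index :=
  [fsfun j in [fset i | i in iota 0 J]%fset =>
     if insub j is Some i then F i : nat else 0%N].
apply: (@sub_finite_set _ _ [set h F | F in [set: {ffun 'I_J -> 'I_n.+1}]]).
  move=> nu' /= nuP; exists [ffun i : 'I_J => inord (nu' i)] => //.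
  apply/fsfunP => j; rewrite fsfun_fun !inE mem_iota /= add0n.
  have := nuP j; case: ifP => [jJ nuj|_]; last by rewrite leqn0 => /eqP ->.
  by rewrite insubT ffunE inordK.
exact/finite_image/finite_finset.
Qed.

Lemma mbox_sub J J' n n' : (J <= J')%N -> (n <= n')%N ->
  (mbox J n `<=` mbox J' n')%fset.
Proof.
move=> JJ' nn'; apply/fsubsetP => nu /mem_mbox nuJ; apply/mem_mbox => j.
have := nuJ j; case: ifP => [jJ /leq_trans -> //|_].
  by rewrite (leq_trans jJ JJ').
by rewrite leqn0 => /eqP ->.
Qed.

Lemma fsub_mbox (L : {fset multi_index}) : exists J n, (L `<=` mbox J n)%fset.
Proof.
elim/finSet_rect: L => L IH.
have [->|[nu nuL]] := fset_0Vmem L; first by exists 0%N, 0%N; exact: fsub0set.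
have [|J [n Ln]] := IH (L `\ nu)%fset; first exact: fproperD1.
pose K := (\max_(j <- finsupp nu) j).+1.
pose m := (\max_(j <- finsupp nu) nu j)%N.
exists (maxn J K), (maxn n m); apply/fsubsetP => mu muL.
have [->|munu] := eqVneq mu nu.
  apply/mem_mbox => j; have [/eqP -> //|] := boolP (nu j == 0)%N.
  rewrite -mem_finsupp => jnu.
  have -> : (j < maxn J K)%N by rewrite leq_max /K ltnS leq_bigmax_seq ?orbT.
  by rewrite leq_max (@leq_bigmax_seq _ _ xpredT (fun j => nu j))// orbT.
apply: (fsubsetP (mbox_sub _ _ _ _ (leq_maxl _ _) (leq_maxl _ _))).
by apply: (fsubsetP Ln); rewrite !inE munu.
Qed.

Lemma mbox0 J n : [fsfun] \in mbox J n.
Proof. by apply/mem_mbox => j; rewrite fsfun0. Qed.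

Lemma mem_mbox_gt0 J n nu j : nu \in mbox J n -> (0 < nu j)%N -> (j < J)%N.
Proof.
move=> /mem_mbox/(_ j); case: ifP => // _; by rewrite leqn0 => /eqP ->.
Qed.

(** Reindexing along the bijection nu |-> nu - e_j, with inverse [minc]; mu_j < n marks the indices
    whose successor is still in the box. *)
Lemma sum_mdec (W : nmodType) J n j (H : multi_index -> W) : (j < J)%N ->
  \sum_(nu <- mbox J n | (0 < nu j)%N) H (mdec nu j) =
  \sum_(mu <- mbox J n | (mu j < n)%N) H mu.
Proof.
move=> jJ; rewrite -[LHS]big_filter -[RHS]big_filter.
rewrite -(big_map (mdec^~ j) xpredT H) /=; apply: perm_big; apply: uniq_perm.
- rewrite map_inj_in_uniq ?filter_uniq ?fset_uniq// => mu nu.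
  rewrite !mem_filter => /andP[muj _] /andP[nuj _] eq_dec.
  by rewrite -(mdecK _ _ muj) -(mdecK _ _ nuj) eq_dec.
- by rewrite filter_uniq ?fset_uniq.
move=> mu; apply/mapP/idP => [[nu]|]; rewrite mem_filter.
  move=> /andP[nuj /mem_mbox nuJ] ->; rewrite mem_filter mdecE eqxx.
  have := nuJ j; rewrite jJ => nujn; apply/andP; split.
    by rewrite prednK.
  apply/mem_mbox => i; rewrite mdecE; case: eqP => [->|_]; last exact: nuJ.
  by rewrite jJ (leq_trans (leq_pred _)).
move=> /andP[muj /mem_mbox muJ]; exists (minc mu j); last by rewrite mincK.
rewrite mem_filter mincE eqxx /=; apply/mem_mbox => i.
by rewrite mincE; case: eqP => [->|_]; [rewrite jJ|exact: muJ].
Qed.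

Lemma sum_finsupp_mbox (W : nmodType) J n nu (P : pred nat) (H : nat -> W) :
  nu \in mbox J n ->
  \sum_(j <- finsupp nu | P j) H j = \sum_(j < J | P j && (0 < nu j)%N) H j.
Proof.
move=> nuJ; rewrite -(big_mkord (fun j => P j && (0 < nu j)%N)) /=.
rewrite [LHS]big_seq_cond -[LHS]big_filter -[RHS]big_filter.
apply: perm_big; apply: uniq_perm; rewrite ?filter_uniq ?iota_uniq ?fset_uniq//.
move=> j; rewrite !mem_filter mem_index_iota finsupp_gt0 /=.
have [nuj|] := boolP (0 < nu j)%N; rewrite ?andbF//=.
by rewrite !andbT (mem_mbox_gt0 _ _ _ _ nuJ nuj) andbT.
Qed.

(** What each index receives from its predecessors is regrouped by the predecessor that sends it;
    each mu sends at most once in each direction j < J. *)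
Lemma sum_sum_mdec (W : nmodType) J n (P : pred nat)
    (H : nat -> multi_index -> W) :
  \sum_(nu <- mbox J n) \sum_(j <- finsupp nu | P j) H j (mdec nu j) =
  \sum_(mu <- mbox J n) \sum_(j < J | P j && (mu j < n)%N) H j mu.
Proof.
rewrite big_seq; under eq_bigr => nu nuJ do
  rewrite (sum_finsupp_mbox _ _ _ _ _ (fun j => H j (mdec nu j)) nuJ)
          big_mkcondr.
rewrite -big_seq [LHS]exchange_big.
under [RHS]eq_bigr do rewrite big_mkcondr.
rewrite [RHS]exchange_big; apply: eq_bigr => j _.
by rewrite -[LHS]big_mkcond -[RHS]big_mkcond; exact: sum_mdec.
Qed.

(** The variable j leaves the support when nu_j = 1, hence the requirement that [G] be neutral at 0.
    A general monoid law covers both products and the total degree. *)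
Lemma big_mdec (T : Type) (idx : T) (op : Monoid.com_law idx)
    (G : nat -> nat -> T) nu j :
  (forall i, G i 0%N = idx) -> (0 < nu j)%N ->
  exists c, \big[op/idx]_(i <- finsupp nu) G i (nu i) = op (G j (nu j)) c /\
    \big[op/idx]_(i <- finsupp (mdec nu j)) G i (mdec nu j i) =
      op (G j (nu j).-1) c.
Proof.
move=> G0 nuj; exists (\big[op/idx]_(i <- (finsupp nu `\ j)%fset) G i (nu i)).
have jnu : j \in finsupp nu by rewrite finsupp_gt0.
split; first by rewrite (big_fsetD1 j jnu).
rewrite (@big_fset_incl _ _ _ _ _ (finsupp nu)); last first.
- by move=> i _; rewrite finsupp_gt0 lt0n negbK => /eqP ->.
- apply/fsubsetP => i; rewrite !finsupp_gt0 mdecE.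
  by case: eqP => // ->.
rewrite (big_fsetD1 j jnu) /= mdecE eqxx; congr (op _ _).
apply: eq_big_seq => i; rewrite !inE mdecE => /andP[ij _].
by rewrite (negPf ij).
Qed.

Lemma prod_mdec (R : comPzSemiRingType) (G : nat -> nat -> R) nu j :
  (forall i, G i 0%N = 1) -> (0 < nu j)%N ->
  exists c, \prod_(i <- finsupp nu) G i (nu i) = G j (nu j) * c /\
    \prod_(i <- finsupp (mdec nu j)) G i (mdec nu j i) = G j (nu j).-1 * c.
Proof. exact: big_mdec. Qed.

Lemma multi_pow_mdec (R : realType) (y : nat -> R) nu j : (0 < nu j)%N ->
  multi_pow y nu = y j * multi_pow y (mdec nu j).
Proof.
move=> nuj; rewrite /multi_pow.
have [//|c [-> ->]] := @prod_mdec R (fun i n => y i ^+ n) nu j _ nuj.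
by rewrite mulrA -exprS prednK.
Qed.

Lemma multi_pow0 (R : realType) (y : nat -> R) : multi_pow y [fsfun] = 1.
Proof. by rewrite /multi_pow finsupp0 big_nil. Qed.

Lemma multi_pow_ge0 (R : realType) (y : nat -> R) nu :
  (forall j, 0 <= y j) -> 0 <= multi_pow y nu.
Proof. by move=> y0; apply: prodr_ge0 => j _; exact: exprn_ge0. Qed.

Lemma multi_pow_le1 (R : realType) (y : nat -> R) nu : cube y ->
  `|multi_pow y nu| <= 1.
Proof.
move=> yC; rewrite /multi_pow normr_prod; apply: prodr_ile1 => j _.
by rewrite normr_ge0 normrX exprn_ile1//= ler_norml yC.
Qed.

Lemma multi_fact_mdec nu j : (0 < nu j)%N ->
  multi_fact nu = (nu j * multi_fact (mdec nu j))%N.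
Proof.
move=> nuj; rewrite /multi_fact.
have [//|c [-> ->]] := @prod_mdec nat (fun i n => n`!) nu j _ nuj.
rewrite -{1}(prednK nuj) factS (prednK nuj); exact/esym/mulnA.
Qed.

Lemma multi_fact0 : multi_fact [fsfun] = 1%N.
Proof. by rewrite /multi_fact finsupp0 big_nil. Qed.

Lemma multi_fact_gt0 nu : (0 < multi_fact nu)%N.
Proof. by apply: prodn_gt0 => j; exact: fact_gt0. Qed.

End multi_index.

(** * Sums over multi-indices *)

Section bounded_sums.
Context {R : realType}.
Implicit Types (F : multi_index -> R) (nu mu : multi_index).

(** For nonnegative [F] this is summability, kept free of extended reals. *)
Definition bounded_sums F := exists C, forall L : {fset multi_index},
  \sum_(nu <- L) F nu <= C.

Lemma sum_fsetD (W : nmodType) (I : choiceType) (A B : {fset I}) (F : I -> W) :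
  (A `<=` B)%fset ->
  \sum_(i <- B) F i = \sum_(i <- A) F i + \sum_(i <- (B `\` A)%fset) F i.
Proof.
move=> AB; rewrite (big_fsetID _ (mem A) B) /=.
congr (_ + _); apply: eq_fbigl => i; rewrite !inE /= andbC//.
by apply: andb_idr => /(fsubsetP AB).
Qed.

Lemma ler_sum_fsub (I : choiceType) (A B : {fset I}) (F : I -> R) :
  (forall i, 0 <= F i) -> (A `<=` B)%fset ->
  \sum_(i <- A) F i <= \sum_(i <- B) F i.
Proof. by move=> F0 AB; rewrite (sum_fsetD _ _ _ _ _ AB) lerDl sumr_ge0. Qed.

Lemma sum_mbox_le F C : (forall nu, 0 <= F nu) ->
  (forall J n, \sum_(nu <- mbox J n) F nu <= C) ->
  forall L : {fset multi_index}, \sum_(nu <- L) F nu <= C.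
Proof.
move=> F0 FC L; have [J [n LJ]] := fsub_mbox L.
by rewrite (le_trans _ (FC J n))// ler_sum_fsub.
Qed.

Lemma bounded_sums_le F G : (forall nu, F nu <= G nu) -> bounded_sums G ->
  bounded_sums F.
Proof.
move=> FG [C GC]; exists C => L; apply: le_trans (GC L).
by apply: ler_sum => nu _.
Qed.

Lemma bounded_sumsD F G : bounded_sums F -> bounded_sums G ->
  bounded_sums (fun nu => F nu + G nu).
Proof.
move=> [C FC] [C' GC]; exists (C + C') => L; rewrite big_split /=.
exact: lerD.
Qed.

Lemma bounded_sumsZ c F : 0 <= c -> bounded_sums F ->
  bounded_sums (fun nu => c * F nu).
Proof.
move=> c0 [C FC]; exists (c * C) => L; rewrite -mulr_sumr.
exact: ler_wpM2l.
Qed.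

(** [L0] attains the supremum of the finite sums up to [e], so a finite set disjoint from it can add
    at most [e]. *)
Lemma bounded_sums_tail F : bounded_sums F -> forall e, 0 < e ->
  exists L0 : {fset multi_index}, forall L : {fset multi_index},
    (forall nu, nu \in L -> nu \notin L0) -> \sum_(nu <- L) F nu <= e.
Proof.
move=> [C FC] e e0.
pose S := [set \sum_(nu <- L) F nu | L in [set: {fset multi_index}]].
have supS : has_sup S.
  split; first by exists (\sum_(nu <- fset0) F nu), fset0.
  by exists C => _ [L _ <-].
have [_ [L0 _ <-] L0S] := sup_adherent e0 supS.
exists L0 => L LL0; rewrite leNgt; apply/negP => Le.
have : \sum_(nu <- (L `|` L0)%fset) F nu <= sup S.
  by apply: (ub_le_sup (proj2 supS)); exists (L `|` L0)%fset.
rewrite (sum_fsetD _ _ L0) ?fsubsetUr//.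
have -> : ((L `|` L0) `\` L0)%fset = L; last by lra.
apply/fsetP => nu; rewrite !inE; have [/LL0 /negPf -> //|] := boolP (nu \in L).
by rewrite /= andNb.
Qed.

Let head k (nu : multi_index) := all (fun j => j < k)%N (finsupp nu).

Let headP k (nu : multi_index) :
  reflect (forall j, (0 < nu j)%N -> (j < k)%N) (head k nu).
Proof.
apply: (iffP allP) => [h j|h j]; first by rewrite -finsupp_gt0; exact: h.
by rewrite finsupp_gt0; exact: h.
Qed.

(* Summing over a box, which is stable under nu |-> nu - e_j, bounds the sum S of F by
   S_{J0} + S/2, where S_{J0} runs over the indices supported in [0, J0[; these
   variables are removed one at a time, (1 - q) S_{k+1} <= S_k. *)
Lemma bounded_sums_rec F (c : nat -> R) (q : R) (J0 : nat) :
  (forall nu, 0 <= F nu) -> 0 <= q < 1 -> (forall j, 0 <= c j) ->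
  (forall J, \sum_(j < J | (J0 <= j)%N) c j <= 2^-1) ->
  (forall nu j, (j < J0)%N -> (0 < nu j)%N -> F nu <= q * F (mdec nu j)) ->
  (forall nu j, (J0 <= j)%N -> (0 < nu j)%N ->
    F nu <= \sum_(i <- finsupp nu | (J0 <= i)%N) c i * F (mdec nu i)) ->
  bounded_sums F.
Proof.
move=> F0 /andP[q0 q1] c0 cJ Fhead Ftail.
have q1' : 0 < 1 - q by rewrite subr_gt0.
exists (2 * (F [fsfun] / (1 - q) ^+ J0)); apply: sum_mbox_le => // J n.
pose S k := \sum_(nu <- mbox J n | head k nu) F nu.
have S0 : S 0%N <= F [fsfun].
  rewrite /S big_mkcond (big_fsetD1 [fsfun] (mbox0 J n)) /= big_seq big1 ?addr0.
    by case: ifP.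
  move=> nu; rewrite !inE => /andP[/multi_index_neq0[j nuj] _].
  by case: headP => // /(_ j nuj); rewrite ltn0.
(* Indices with nu_k = 0 make up S_k; the others are shifted by e_k, which costs a factor q and
   keeps the support in [0, k]. *)
have Sle k : (k < J0)%N -> (1 - q) * S k.+1 <= S k.
  move=> kJ0; rewrite mulrBl mul1r lerBlDr.
  rewrite [leLHS](bigID (fun nu : multi_index => nu k == 0%N)) /=.
  apply: lerD.
    rewrite le_eqVlt; apply/orP; left; apply/eqP/eq_bigl => nu.
    apply/andP/headP => [[/headP nuk /eqP nuk0] j nuj|nuk].
      have := nuk j nuj; rewrite ltnS leq_eqVlt => /orP[/eqP jk|//].
      by move: nuj; rewrite jk nuk0.
    split; first by apply/headP => j /nuk/ltnW.
    by rewrite -leqn0 leqNgt; apply/negP => /nuk; rewrite ltnn.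
  rewrite mulr_sumr.
  have [kJ|Jk] := ltnP k J; last first.
    rewrite big_seq_cond big1 ?sumr_ge0// => [nu _|nu]; first exact: mulr_ge0.
    move=> /and3P[nuJ _]; rewrite -lt0n => /(mem_mbox_gt0 _ _ _ _ nuJ).
    by rewrite ltnNge Jk.
  pose H nu := if head k.+1 nu then q * F nu else 0.
  have H0 nu : 0 <= H nu by rewrite /H; case: ifP => // _; exact: mulr_ge0.
  rewrite [leRHS]big_mkcond /=.
  apply: (@le_trans _ _ (\sum_(nu <- mbox J n | (0 < nu k)%N) H (mdec nu k))).
    under eq_bigl => nu do rewrite andbC -lt0n.
    rewrite big_mkcondr /=; apply: ler_sum => nu nuk; case: ifP => // /headP h.
    rewrite /H ifT; first exact: Fhead.
    apply/headP => j; rewrite mdecE; case: eqP => [-> _|_]; first by [].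
    exact: h.
  rewrite sum_mdec// big_mkcond /=; apply: ler_sum => nu _.
  by case: ifP => // _; exact: H0.
have SJ0 k : (k <= J0)%N -> S k <= F [fsfun] / (1 - q) ^+ k.
  elim: k => [_|k IHk kJ0]; first by rewrite expr0 divr1.
  rewrite exprS invfM mulrCA -ler_pdivrMl ?invr_gt0// invrK.
  by rewrite (le_trans (Sle k kJ0)) ?IHk ?(ltnW kJ0).
set T := \sum_(nu <- mbox J n) F nu.
suff : T <= S J0 + 2^-1 * T by have := SJ0 J0 (leqnn _); lra.
rewrite {1}/T (bigID (head J0)) /=; apply: lerD => //.
have G0 nu : 0 <= \sum_(i <- finsupp nu | (J0 <= i)%N) c i * F (mdec nu i).
  by apply: sumr_ge0 => i _; exact: mulr_ge0.
apply: (@le_trans _ _ (\sum_(nu <- mbox J n)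
    \sum_(i <- finsupp nu | (J0 <= i)%N) c i * F (mdec nu i))).
  (* An index outside [head J0] has a positive entry at some j >= J0, so the tail recursion applies
     to it. *)
  rewrite big_mkcond /=; apply: ler_sum => nu _; case: ifPn => // /headP nh.
  have [j /not_implyP[nuj /negP]] : exists j, ~ ((0 < nu j)%N -> (j < J0)%N).
    by apply: contrapT => /forallNP h; apply: nh => j; apply: contrapT => /h.
  by rewrite -leqNgt => J0j; exact: Ftail nuj.
rewrite (sum_sum_mdec _ _ _ _ (fun j mu => c j * F mu)) /T mulr_sumr.
apply: ler_sum => mu _; rewrite -mulr_suml ler_wpM2r//.
apply: le_trans (cJ J); rewrite [leLHS]big_mkcond [leRHS]big_mkcond /=.
by apply: ler_sum => j _; case: (J0 <= j)%N; case: (mu j < n)%N.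
Qed.

End bounded_sums.

(** * Derivatives of the solution with respect to the parameters *)

Section linear_forms.
Context {R : realType} {W : normedModType R}.

(** A predicate rather than a structure, because the forms at hand are linear only for admissible
    coefficients or parameters. *)
Definition lform (F : W -> R) := forall c w w', F (c *: w + w') = c * F w + F w'.

Variable F : W -> R.
Hypothesis linF : lform F.

Lemma lform0 : F 0 = 0.
Proof.
by have := linF (-1) 0 0; rewrite scaler0 add0r; lra.
Qed.

Lemma lformD w w' : F (w + w') = F w + F w'.
Proof. by rewrite -[w in LHS]scale1r linF mul1r. Qed.

Lemma lformZ c w : F (c *: w) = c * F w.
Proof. by rewrite -[c *: w]addr0 linF lform0 addr0. Qed.

Lemma lformN w : F (- w) = - F w.
Proof. by rewrite -scaleN1r lformZ mulN1r. Qed.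

Lemma lformB w w' : F (w - w') = F w - F w'.
Proof. by rewrite lformD lformN. Qed.

Lemma lform_sum I (r : seq I) (P : pred I) (G : I -> W) :
  F (\sum_(i <- r | P i) G i) = \sum_(i <- r | P i) F (G i).
Proof. exact: (big_morph _ lformD lform0). Qed.

(** Boundedness is assumed from above only; the lower bound is the upper one at -w. *)
Lemma lform_norm M : (forall w, F w <= M * `|w|) -> forall w, `|F w| <= M * `|w|.
Proof.
move=> FM w; rewrite ler_norml FM andbT lerNl -lformN -normrN; exact: FM.
Qed.

Lemma lform_cvg M {T : Type} {G : set_system T} {FG : Filter G}
    (h : T -> W) (w : W) :
  (forall w, F w <= M * `|w|) -> h x @[x --> G] --> w ->
  F (h x) @[x --> G] --> F w.
Proof.
move=> FM hw; have /lform_norm FM' := FM; apply/cvgrPdist_lt => e e0.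
have M0 : 0 < `|M| + 1 by rewrite ltr_wpDl.
have /cvgrPdist_lt/(_ (e / (`|M| + 1))) := hw.
rewrite divr_gt0// => /(_ isT); apply: filterS => x hx.
rewrite -lformB (le_lt_trans (FM' _))//.
move: hx; rewrite ltr_pdivlMr// mulrC; apply: le_lt_trans.
by rewrite ler_wpM2r// (le_trans (ler_norm _))// lerDl.
Qed.

End linear_forms.

(** Completeness in the shape produced by stability: the distance of two difference quotients is at
    most the sum of their moduli. *)
Lemma cauchy_modulus_cvg {R : realType} {W : completeNormedModType R} {T : Type}
    {G : set_system T} {FG : ProperFilter G} (q : T -> W) (e : T -> R)
    (P : set T) :
  G P -> e x @[x --> G] --> 0 ->
  (forall h h', P h -> P h' -> `|q h - q h'| <= e h + e h') ->
  cvg (q x @[x --> G]).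
Proof.
move=> GP e0 qe; apply/cauchy_cvgP/cauchy_exP => _/posnumP[eps].
have e2 : 0 < eps%:num / 2 by [].
have /cvgr0Pnorm_lt/(_ _ e2) small := e0.
have [h0 [Ph0 eh0]] := filter_ex (filterI GP small).
exists (q h0); apply: filterS (filterI GP small) => h [Ph eh].
rewrite -ball_normE /= (le_lt_trans (qe _ _ Ph0 Ph))//.
rewrite [ltRHS]splitr ltrD//; exact: le_lt_trans (ler_norm _) _.
Qed.

Lemma near_eq_lim {R : realType} {T : Type} {G : set_system T}
    {FG : ProperFilter G} (f f' : T -> R) (a a' : R) :
  f x @[x --> G] --> a -> f' x @[x --> G] --> a' ->
  (\forall x \near G, f x = f' x) -> a = a'.
Proof.
move=> fa f'a' ff'; have f'a : f' x @[x --> G] --> a.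
  exact: cvg_trans (near_eq_cvg ff') fa.
by rewrite -(cvg_lim (@norm_hausdorff _ _) f'a) (cvg_lim (@norm_hausdorff _ _) f'a').
Qed.

(** Stability is known on the cube only, so a difference quotient needs room on both sides of y_j.
    One coordinate moves at a time, hence coordinatewise strictness is enough. *)
Definition ocube {R : realType} : set (nat -> R) := [set y | forall j, -1 < y j < 1].

Lemma ocube_cube {R : realType} (y : nat -> R) : ocube y -> cube y.
Proof. by move=> yO j; have /andP[/ltW -> /ltW ->] := yO j. Qed.

Lemma ocube0 {R : realType} : (ocube : set (nat -> R)) (fun=> 0).
Proof. by move=> j; rewrite ltrN10 ltr01. Qed.

Lemma upd_id {R : realType} (y : nat -> R) j : [eta y with j |-> y j] = y :> (nat -> R).
Proof. by apply/funext => i /=; case: eqP => [->|]. Qed.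

Section parametric_derivatives.
Context {R : realType} {V Q : completeNormedModType R}.
Variables (A : (nat -> R) -> V -> V -> R) (B : nat -> V -> V -> R).
Variables (b : V -> Q -> R) (f : V -> R) (g : Q -> R).
Variables (gamma delta M Cs : R).
Hypothesis A_lin : forall y, cube y -> forall v, lform (A y ^~ v).
Hypothesis A_bnd : forall y, cube y -> forall w v,
  A y w v <= gamma * `|w| * `|v|.
Hypothesis B_lin : forall j v, lform (B j ^~ v).
Hypothesis B_bnd : forall j w v, B j w v <= M * `|w| * `|v|.
Hypothesis b_linl : forall q, lform (b ^~ q).
Hypothesis b_linr : forall v, lform (b v).
Hypothesis b_bnd : forall v q, b v q <= delta * `|v| * `|q|.
Hypothesis A_upd : forall y j h, cube y -> cube [eta y with j |-> h] ->
  forall w v, A [eta y with j |-> h] w v = A y w v + (h - y j) * B j w v.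
Hypothesis M_ge0 : 0 <= M.
Hypothesis Cs_ge0 : 0 <= Cs.
Hypothesis stab : forall y, cube y -> forall w r c, 0 <= c ->
  (forall q, b w q = 0) -> (forall v, A y w v + b v r <= c * `|v|) ->
  `|w| <= Cs * c /\ `|r| <= Cs * c.
Variables (u : (nat -> R) -> V) (p : (nat -> R) -> Q).
Hypothesis up_sol : forall y, cube y ->
  (forall v, A y (u y) v + b v (p y) = f v) /\ (forall q, b (u y) q = g q).

(* [u] and [p] are the only solutions known to exist: the derivatives below are limits
   of difference quotients, which are Cauchy by the stability of the problem. *)
Definition partials {W : normedModType R} (l : seq nat)
    (psi : (nat -> R) -> W) := foldr partial psi l.

Let Du l := partials l u.
Let Dp l := partials l p.

Let del (l : seq nat) i := take i l ++ drop i.+1 l.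

(** Product rule: the form is affine in each parameter with slope [B j], so at most one of the
    differentiations in [l] falls on it, the one at position i. *)
Let rhs (l : seq nat) (y : nat -> R) (v : V) :=
  \sum_(i < size l) B (nth 0%N l i) (Du (del l i) y) v.

Let sys l := forall y, ocube y ->
  (forall v, A y (Du l y) v + b v (Dp l y) =
     (if nilp l then f v else 0) - rhs l y v) /\
  (forall q, b (Du l y) q = if nilp l then g q else 0).

Let dq {W : normedModType R} (psi : (nat -> R) -> W) y j (h : R) :=
  h^-1 *: (psi [eta y with j |-> h + y j] - psi y).

(** [lim] is total, so that [partial] is a genuine derivative has to be established separately. *)
Let dif l := forall y, ocube y -> forall j,
  dq (Du l) y j h @[h --> 0^'] --> Du (j :: l) y /\
  dq (Dp l) y j h @[h --> 0^'] --> Dp (j :: l) y.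

Let ocube_near y j : ocube y ->
  \forall h \near (0 : R)^', h != 0 /\ ocube [eta y with j |-> h + y j].
Proof.
move=> yO; have /andP[yj1 yj2] := yO j.
have e0 : 0 < Num.min (y j + 1) (1 - y j) by rewrite lt_min; lra.
have Hlt := dnbhs0_lt e0.
near=> h; split; first by near: h; exact: nbhs_dnbhs_neq.
move=> i /=; case: eqP => [_|_]; last exact: yO.
have : `|h| < Num.min (y j + 1) (1 - y j) by near: h; exact: Hlt.
by rewrite lt_min !ltr_norml => /andP[/andP[? ?] /andP[? ?]]; lra.
Unshelve. all: by end_near. Qed.

Let partialE {W : normedModType R} (psi : (nat -> R) -> W) y j :
  partial j psi y = lim (dq psi y j h @[h --> 0^']).
Proof.
have E : (fun h => h^-1 *: (psi [eta y with j |-> h + y j] -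
    psi [eta y with j |-> y j])) = dq psi y j.
  by apply/funext => h; rewrite /dq upd_id.
exact: (congr1 (fun q : R -> W => lim (q h @[h --> 0^'])) E).
Qed.

Let dqE {W : normedModType R} (psi : (nat -> R) -> W) y j (h : R) : h != 0 ->
  psi [eta y with j |-> h + y j] - psi y = h *: dq psi y j h.
Proof. by move=> h0; rewrite /dq scalerA divff// scale1r. Qed.

Let dif_cvg {W : completeNormedModType R} (psi : (nat -> R) -> W) y j (w : W) :
  dq psi y j h @[h --> 0^'] --> w ->
  psi [eta y with j |-> h + y j] @[h --> 0^'] --> psi y.
Proof.
move=> dqw.
have -> : psi y = 0 *: w + psi y by rewrite scale0r add0r.
have h0 : (h : R) @[h --> 0^'] --> (0 : R) by exact: nbhs_dnbhs.
have : (h *: dq psi y j h + psi y) @[h --> 0^'] --> 0 *: w + psi y.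
  by apply: cvgD (cvgZ h0 dqw) (cvg_cst _).
apply: cvg_trans; apply: near_eq_cvg; near=> h.
by rewrite -dqE ?subrK//; near: h; exact: nbhs_dnbhs_neq.
Unshelve. all: by end_near. Qed.

Let BN_le j w v : - B j w v <= M * `|w| * `|v|.
Proof. by rewrite -(lformN _ (B_lin _ _)) (le_trans (B_bnd _ _ _))// normrN. Qed.

Let rhsB l y y' v : rhs l y v - rhs l y' v =
  \sum_(i < size l) B (nth 0%N l i) (Du (del l i) y - Du (del l i) y') v.
Proof.
by rewrite /rhs -sumrB; apply: eq_bigr => i _; rewrite (lformB _ (B_lin _ _)).
Qed.

Let sysB l : sys l -> forall y y', ocube y -> ocube y' -> forall q,
  b (Du l y - Du l y') q = 0.
Proof.
move=> sl y y' /sl[_ sy] /sl[_ sy'] q.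
by rewrite (lformB _ (b_linl q)) sy sy' subrr.
Qed.

(** Stability at the moved point: the difference of the two solutions has a residual made of
    increments of shorter derivatives, which tend to 0, and of a term of order h. *)
Let step_cvg l : sys l -> (forall i, (i < size l)%N -> dif (del l i)) ->
  forall y, ocube y -> forall j,
  Du l [eta y with j |-> h + y j] @[h --> 0^'] --> Du l y.
Proof.
move=> sl dl y yO j.
pose z h := [eta y with j |-> h + y j].
pose e h := Cs * (M * (\sum_(i < size l) `|Du (del l i) (z h) - Du (del l i) y|)
  + `|h| * (M * `|Du l y|)).
have e0 : e h @[h --> 0^'] --> (0 : R).
  have E0 : Cs * (M * (\sum_(i < size l) (0 : R))
      + `|0 : R| * (M * `|Du l y|)) = 0.
    by rewrite big1// !(normr0, mul0r, mulr0, addr0).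
  suff : e h @[h --> 0^'] --> Cs * (M * (\sum_(i < size l) (0 : R))
      + `|0 : R| * (M * `|Du l y|)) by rewrite E0.
  apply: cvgMl_tmp; apply: cvgD.
    apply: cvgMl_tmp; apply: cvg_big; first exact: add_continuous.
    move=> i _; have [di _] := dl _ (ltn_ord i) _ yO j.
    apply/norm_cvg0P; apply/subr_cvg0; exact: (dif_cvg (Du (del l i)) _ _ _ di).
  apply: cvgMr_tmp; apply: cvg_norm; exact: nbhs_dnbhs.
apply/subr_cvg0; apply/norm_cvg0P.
apply: (@squeeze_cvgr _ _ _ _ (fun=> 0) e) => //; last exact: cvg_cst.
near=> h; rewrite normr_ge0 /=.
have [h0 zO] : h != 0 /\ ocube (z h) by near: h; exact: ocube_near.
have yC := ocube_cube _ yO; have zC := ocube_cube _ zO.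
apply: (proj1 (stab _ zC _ (Dp l (z h) - Dp l y) _ _ (sysB _ sl _ _ zO yO) _)).
  by rewrite addr_ge0// !mulr_ge0// sumr_ge0.
move=> v; rewrite (lformB _ (A_lin _ zC _)) (lformB _ (b_linr _)).
rewrite [A (z h) (Du l y) v]A_upd// addrK.
have [/(_ v) sz _] := sl _ zO; have [/(_ v) sy _] := sl _ yO.
have -> : A (z h) (Du l (z h)) v - (A y (Du l y) v + h * B j (Du l y) v) +
    (b v (Dp l (z h)) - b v (Dp l y)) =
    - (rhs l (z h) v - rhs l y v) + h * - B j (Du l y) v by lra.
rewrite rhsB mulrDl; apply: lerD.
  rewrite mulr_sumr mulr_suml -sumrN; apply: ler_sum => i _; exact: BN_le.
rewrite -mulrA (le_trans (ler_norm _))// normrM ler_wpM2l//.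
by rewrite normrN ler_norml B_bnd lerNl BN_le.
Unshelve. all: by end_near. Qed.

(** The form at z is rewritten as the form at y plus h [B j]; this is why the last term is evaluated
    at the moved point. *)
Let dq_eq l : sys l -> forall y, ocube y -> forall j h, h != 0 ->
  ocube [eta y with j |-> h + y j] -> forall v,
  A y (dq (Du l) y j h) v + b v (dq (Dp l) y j h) =
  - (\sum_(i < size l) B (nth 0%N l i) (dq (Du (del l i)) y j h) v) -
  B j (Du l [eta y with j |-> h + y j]) v.
Proof.
move=> sl y yO j h h0 zO v; set z := [eta y with j |-> h + y j].
have yC := ocube_cube _ yO; have zC := ocube_cube _ zO.
have [/(_ v) sz _] := sl _ zO; have [/(_ v) sy _] := sl _ yO.
move: sz; rewrite [A _ _ _]A_upd// addrK => sz.
rewrite /dq (lformZ _ (A_lin _ yC _)) (lformZ _ (b_linr _)).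
rewrite (lformB _ (A_lin _ yC _)) (lformB _ (b_linr _)).
under eq_bigr do rewrite (lformZ _ (B_lin _ _)).
rewrite -mulr_sumr -rhsB.
apply: (mulfI h0); rewrite -mulrDr mulrA divff// mul1r mulrBr mulrN mulrA.
by rewrite divff// mul1r -/z; lra.
Qed.

(** Two difference quotients solve the same problem at y with different data. Stability bounds their
    distance by that of the data, which converge by the cases of shorter lists and by [step_cvg]. *)
Let step_dif l : sys l -> (forall i, (i < size l)%N -> dif (del l i)) -> dif l.
Proof.
move=> sl dl y yO j.
have cl := step_cvg _ sl dl _ yO j.
pose z h := [eta y with j |-> h + y j].
pose e h := Cs * (M * (\sum_(i < size l)
    `|dq (Du (del l i)) y j h - Du (j :: del l i) y| + `|Du l (z h) - Du l y|)).
have e0 : e h @[h --> 0^'] --> (0 : R).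
  have E0 : Cs * (M * (\sum_(i < size l) (0 : R) + 0)) = 0.
    by rewrite big1// !(mulr0, addr0).
  suff : e h @[h --> 0^'] --> Cs * (M * (\sum_(i < size l) (0 : R) + 0)).
    by rewrite E0.
  apply: cvgMl_tmp; apply: cvgMl_tmp; apply: cvgD; last exact/norm_cvg0P/subr_cvg0.
  apply: cvg_big; first exact: add_continuous.
  move=> i _; have [di _] := dl _ (ltn_ord i) _ yO j.
  exact/norm_cvg0P/subr_cvg0.
have yC := ocube_cube _ yO.
have bdq h : ocube (z h) -> forall q, b (dq (Du l) y j h) q = 0.
  by move=> zO q; rewrite (lformZ _ (b_linl q)) (sysB _ sl)// mulr0.
have est h h' : (h != 0 /\ ocube (z h)) -> (h' != 0 /\ ocube (z h')) ->
    `|dq (Du l) y j h - dq (Du l) y j h'| <= e h + e h' /\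
    `|dq (Dp l) y j h - dq (Dp l) y j h'| <= e h + e h'.
  move=> [h0 zO] [h'0 z'O]; rewrite -mulrDr; apply: stab => //.
  - by rewrite -mulrDr mulr_ge0// !addr_ge0// sumr_ge0.
  - by move=> q; rewrite (lformB _ (b_linl q)) !bdq// subrr.
  move=> v; rewrite (lformB _ (A_lin _ yC _)) (lformB _ (b_linr _)).
  rewrite addrACA -opprD !dq_eq// -/(z h) -/(z h').
  pose S h := \sum_(i < size l) B (nth 0%N l i) (dq (Du (del l i)) y j h) v.
  pose s h := \sum_(i < size l)
    `|dq (Du (del l i)) y j h - Du (j :: del l i) y|.
  pose d h := `|Du l (z h) - Du l y|.
  rewrite -/(S h) -/(S h') -/(s h) -/(s h') -/(d h) -/(d h').
  have SB : - (S h - S h') <= M * (s h + s h') * `|v|.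
    rewrite /S /s -sumrB -sumrN -big_split /= mulr_sumr mulr_suml.
    apply: ler_sum => i _; rewrite -(lformB _ (B_lin _ v)).
    rewrite (le_trans (BN_le _ _ _))// ler_wpM2r// ler_wpM2l//.
    rewrite [X in _ <= _ + X]distrC (le_trans _ (ler_normD _ _))//.
    by rewrite subrKA.
  have TB : - (B j (Du l (z h)) v - B j (Du l (z h')) v) <=
      M * (d h + d h') * `|v|.
    rewrite -(lformB _ (B_lin _ v)) (le_trans (BN_le _ _ _))//.
    rewrite ler_wpM2r// ler_wpM2l// /d [X in _ <= _ + X]distrC.
    by rewrite (le_trans _ (ler_normD _ _))// subrKA.
  by lra.
have Hnear := ocube_near _ j yO.
split.
  have : cvg (dq (Du l) y j h @[h --> 0^']).
    by apply: (@cauchy_modulus_cvg _ _ R (0 : R)^' _ _ e _ Hnear e0) => h h' Hh Hh';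
      have [] := est _ _ Hh Hh'.
  by have -> : Du (j :: l) y = lim (dq (Du l) y j h @[h --> 0^']) by exact: partialE.
have : cvg (dq (Dp l) y j h @[h --> 0^']).
  by apply: (@cauchy_modulus_cvg _ _ R (0 : R)^' _ _ e _ Hnear e0) => h h' Hh Hh';
    have [] := est _ _ Hh Hh'.
by have -> : Dp (j :: l) y = lim (dq (Dp l) y j h @[h --> 0^']) by exact: partialE.
Qed.

(** Passage to the limit in [dq_eq]. Deleting the head of [j :: l] gives the new term of the product
    rule; the other deletions keep j in front. *)
Let step_sys l : sys l -> dif l -> (forall i, (i < size l)%N -> dif (del l i)) ->
  forall j, sys (j :: l).
Proof.
move=> sl dl ddl j y yO; have yC := ocube_cube _ yO; split => [v|q] /=.
  have [du dp] := dl y yO j.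
  have L : A y (dq (Du l) y j h) v + b v (dq (Dp l) y j h) @[h --> 0^'] -->
      A y (Du (j :: l) y) v + b v (Dp (j :: l) y).
    apply: cvgD.
      apply: (lform_cvg _ (A_lin _ yC v) (gamma * `|v|) _ _ _ du) => w.
      by rewrite mulrAC; exact: A_bnd.
    exact: (lform_cvg _ (b_linr v) (delta * `|v|) _ _ _ dp).
  have B_bnd' i : forall w, B i w v <= M * `|v| * `|w|.
    by move=> w; rewrite mulrAC; exact: B_bnd.
  have K : - (\sum_(i < size l) B (nth 0%N l i) (dq (Du (del l i)) y j h) v) -
        B j (Du l [eta y with j |-> h + y j]) v @[h --> 0^'] -->
      - (\sum_(i < size l) B (nth 0%N l i) (Du (j :: del l i) y) v) -
        B j (Du l y) v.
    apply: cvgB.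
      apply: cvgN; apply: cvg_big; first exact: add_continuous.
      move=> i _; have [di _] := ddl _ (ltn_ord i) _ yO j.
      exact: (lform_cvg _ (B_lin _ v) _ _ _ (B_bnd' _) di).
    exact: (lform_cvg _ (B_lin _ v) _ _ _ (B_bnd' _) (dif_cvg _ _ _ _ du)).
  have -> : rhs (j :: l) y v = B j (Du l y) v +
      \sum_(i < size l) B (nth 0%N l i) (Du (j :: del l i) y) v.
    by rewrite /rhs big_ord_recl /del /= drop0.
  rewrite sub0r opprD [RHS]addrC.
  apply: near_eq_lim L K _; near=> h.
  have [h0 zO] : h != 0 /\ ocube [eta y with j |-> h + y j].
    by near: h; exact: ocube_near.
  by rewrite (dq_eq _ sl).
have [du _] := dl y yO j.
have L : b (dq (Du l) y j h) q @[h --> 0^'] --> b (Du (j :: l) y) q.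
  apply: (lform_cvg _ (b_linl q) (delta * `|q|) _ _ _ du) => w.
  by rewrite mulrAC; exact: b_bnd.
have K : (0 : R) @[h --> (0 : R)^'] --> (0 : R) by exact: cvg_cst.
apply: near_eq_lim L K _; near=> h.
have [h0 zO] : h != 0 /\ ocube [eta y with j |-> h + y j].
  by near: h; exact: ocube_near.
by rewrite (lformZ _ (b_linl q)) (sysB _ sl)// mulr0.
Unshelve. all: by end_near. Qed.

Let size_del l i : (i < size l)%N -> size (del l i) = (size l).-1.
Proof.
move=> il; rewrite size_cat size_take il size_drop subnS.
by move: il; case: (size l) => // n; rewrite ltnS => /subnKC /= <-; lia.
Qed.

(** Induction on the length: the lists [del l i] are shorter, and their differentiability drives
    both steps. *)
Let sys_dif n l : (size l <= n)%N -> sys l /\ dif l.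
Proof.
elim: n l => [|n IHn] [|j l] //= ln.
- have s0 : sys [::].
    move=> y /ocube_cube /up_sol[uy gy]; split => // v.
    by rewrite uy /rhs big_ord0 subr0.
  by split => //; apply: step_dif.
- exact: IHn.
have [sl dl] := IHn l ln.
have sjl : sys (j :: l).
  apply: step_sys => // i il; apply: (proj2 (IHn _ _)).
  by rewrite size_del// (leq_trans (leq_pred _)).
split => //; apply: step_dif => // i il; apply: (proj2 (IHn _ _)).
by rewrite size_del.
Qed.

Let sys_all l : sys l. Proof. by have [] := sys_dif _ l (leqnn _). Qed.

Let del_perm l i : (i < size l)%N -> perm_eq (del l i) (rem (nth 0%N l i) l).
Proof.
move=> il; rewrite -(perm_cons (nth 0%N l i)).
rewrite -(permPr (perm_to_rem (mem_nth 0%N il))).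
rewrite -[X in perm_eq _ X](cat_take_drop i) (drop_nth 0%N il).
by rewrite perm_sym perm_catC /= perm_cons perm_catC.
Qed.

(** Once shorter lists are known to be insensitive to order, deletion at a position becomes removal
    of a value, and the sum no longer sees the order of [l]. *)
Let rhs_rem (n : nat) :
  (forall l l', (size l <= n)%N -> perm_eq l l' -> forall y, ocube y ->
    Du l y = Du l' y) ->
  forall l, (size l <= n.+1)%N -> forall y, ocube y -> forall v,
  rhs l y v = \sum_(x <- l) B x (Du (rem x l) y) v.
Proof.
move=> IH l ln y yO v; rewrite (big_nth 0%N) big_mkord.
apply: eq_bigr => i _; congr (B _ _ _); apply: IH => //; last exact: del_perm.
by rewrite size_del//; case: (size l) ln.
Qed.

(** Derivatives commute because both orders solve the same saddle point problem: stability with c =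
    0 is uniqueness. *)
Lemma partials_perm l l' : perm_eq l l' -> forall y, ocube y ->
  partials l u y = partials l' u y /\ partials l p y = partials l' p y.
Proof.
have [n] := ubnPleq (size l).
elim: n l l' => [|n IHn] l l' ln ll' y yO.
  by move: ln ll'; rewrite leqn0 size_eq0 perm_sym => /eqP -> /perm_nilP ->.
have yC := ocube_cube _ yO.
have IH l1 l2 : (size l1 <= n)%N -> perm_eq l1 l2 -> forall y, ocube y ->
    Du l1 y = Du l2 y.
  by move=> l1n l12 y' y'O; have [] := IHn _ _ l1n l12 _ y'O.
have nl : nilp l' = nilp l by rewrite /nilp (perm_size ll').
have ln' : (size l' <= n.+1)%N by rewrite -(perm_size ll').
have rE v : rhs l y v = rhs l' y v.
  rewrite !(rhs_rem n)// (perm_big _ ll') /=.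
  rewrite big_seq [RHS]big_seq; apply: eq_bigr => x xl'; congr (B _ _ _).
  have xl : x \in l by rewrite (perm_mem ll').
  apply: IH => //; first by rewrite size_rem// -ltnS prednK//; case: (l) xl.
  rewrite -(perm_cons x) -(permPl (perm_to_rem xl)).
  by rewrite -(permPr (perm_to_rem xl')).
have [su sg] := sys_all l _ yO; have [su' sg'] := sys_all l' _ yO.
have [//||v|] := stab _ yC (Du l y - Du l' y) (Dp l y - Dp l' y) 0.
- by move=> q; rewrite (lformB _ (b_linl q)) sg sg' nl subrr.
- rewrite (lformB _ (A_lin _ yC _)) (lformB _ (b_linr _)) addrACA -opprD.
  by rewrite su su' rE nl subrr mul0r.
by rewrite mulr0 !normr_le0 !subr_eq0 => /eqP ? /eqP.
Qed.

(** [mixed_partial] differentiates along this list, and counting its entries decides when two such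
    lists are permutations of each other. *)
Let mlist (nu : multi_index) := flatten [seq nseq (nu j) j | j <- finsupp nu].

Let count_mlist nu j : count_mem j (mlist nu) = nu j.
Proof.
rewrite count_flatten sumnE !big_map.
under eq_bigr do rewrite count_nseq /=.
have [jnu|jnu] := boolP (j \in finsupp nu).
  rewrite (big_fsetD1 j)//= eqxx mul1n big_seq big1 ?addn0// => i.
  by rewrite !inE => /andP[/negPf -> _].
rewrite big_seq big1 => [|i inu].
  by move: jnu; rewrite mem_finsupp negbK => /eqP.
by have [ij|] := eqVneq i j; [rewrite -ij inu in jnu|].
Qed.

Let mixed_partialE {W : normedModType R} nu (psi : (nat -> R) -> W) :
  mixed_partial nu psi = partials (mlist nu) psi.
Proof.
rewrite /mixed_partial /partials /mlist.
elim: (enum_fset (finsupp nu)) => //= j s ->; rewrite foldr_cat.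
by elim: (nu j) => //= n ->.
Qed.

Let rem_mlist (nu : multi_index) j : (0 < nu j)%N ->
  perm_eq (rem j (mlist nu)) (mlist (mdec nu j)).
Proof.
move=> nuj; apply/allP => i _; apply/eqP => /=.
rewrite count_mem_rem !count_mlist mdecE eq_sym.
by case: eqP => [->|_]; rewrite ?subn1 ?subn0.
Qed.

Let nilp_mlist nu : nilp (mlist nu) = (nu == [fsfun]).
Proof.
apply/nilP/eqP => [nu0|->]; last by rewrite /mlist finsupp0.
by apply/fsfunP => j; rewrite fsfun0 -count_mlist nu0.
Qed.

(** The variable j occurs nu_j times in the list, and nu_j / nu! = 1 / (nu - e_j)!, so no
    combinatorial factor survives. *)
Lemma taylor_recursion nu :
  (forall v, A (fun=> 0) (taylor_coef u nu) v + b v (taylor_coef p nu) =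
    (if nu == [fsfun] then f v else 0) -
    \sum_(j <- finsupp nu) B j (taylor_coef u (mdec nu j)) v) /\
  (forall q, b (taylor_coef u nu) q = if nu == [fsfun] then g q else 0).
Proof.
have c0 := ocube_cube _ (@ocube0 R).
have [su sg] := sys_all (mlist nu) _ ocube0.
have F0 : (multi_fact nu)%:R != 0 :> R by rewrite pnatr_eq0 -lt0n multi_fact_gt0.
rewrite /taylor_coef !mixed_partialE; split => [v|q]; last first.
  rewrite (lformZ _ (b_linl q)) sg nilp_mlist; case: eqP => [->|_].
    by rewrite multi_fact0 invr1 mul1r.
  by rewrite mulr0.
rewrite (lformZ _ (A_lin _ c0 v)) (lformZ _ (b_linr v)) -mulrDr su nilp_mlist.
rewrite mulrBr; congr (_ - _).
  by case: eqP => [->|_]; rewrite ?mulr0// multi_fact0 invr1 mul1r.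
rewrite (rhs_rem (size (mlist nu)) _ _ _ _ ocube0)//; last first.
  by move=> l l' _ ll' y yO; have [] := partials_perm _ _ ll' _ yO.
rewrite /mlist big_flatten /= big_map mulr_sumr.
apply: eq_big_seq => j; rewrite finsupp_gt0 => nuj.
rewrite big_nseq iter_addr_0 (lformZ _ (B_lin j v)) mixed_partialE.
rewrite -[flatten _]/(mlist nu).
have -> : Du (rem j (mlist nu)) (fun=> 0) = Du (mlist (mdec nu j)) (fun=> 0).
  by have [] := partials_perm _ _ (rem_mlist _ _ nuj) _ ocube0.
rewrite -[B _ _ _ *+ _]mulr_natl mulrA; congr (_ * _).
rewrite (multi_fact_mdec _ _ nuj) natrM invfM mulrAC mulVf ?mul1r//.
by rewrite pnatr_eq0 -lt0n.
Qed.

End parametric_derivatives.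

(** A quadratic in s that is nowhere negative has nonpositive discriminant; s = X / Y is the optimal
    choice. For Y = 0 and X nonzero, s = (E + 1) / X is contradictory. *)
Lemma discriminant_le {R : realFieldType} (X E Y : R) : 0 <= E -> 0 <= Y ->
  (forall s, 2 * s * X <= E + s ^+ 2 * Y) -> X ^+ 2 <= E * Y.
Proof.
move=> E0 Y0 h; have [Y_eq0|Y_neq0] := eqVneq Y 0.
  have [->|X0] := eqVneq X 0; first by rewrite expr0n mulr_ge0.
  have := h ((E + 1) / X); rewrite Y_eq0 !mulr0 addr0 -mulrA divfK//; lra.
have Y_gt0 : 0 < Y by rewrite lt_def Y_neq0.
rewrite -ler_pdivrMr//; have := h (X / Y).
have -> : 2 * (X / Y) * X = 2 * (X ^+ 2 / Y) by field.
have -> : (X / Y) ^+ 2 * Y = X ^+ 2 / Y by field.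
lra.
Qed.

(** Testing with v = w removes r because w is in the kernel, so |w| <= c / alpha. The inf-sup
    condition then bounds r through b(v, r), the residual minus a(w, v). [Cs] adds up the two
    constants. *)
Lemma saddle_stability {R : realType} {V Q : normedModType R}
    (a : V -> V -> R) (b : V -> Q -> R) (alpha beta gamma : R) :
  0 < alpha -> 0 < beta -> 0 <= gamma ->
  (forall v, lform (a ^~ v)) ->
  (forall w v, a w v <= gamma * `|w| * `|v|) ->
  (forall v, (forall q, b v q = 0) -> alpha * `|v| ^+ 2 <= a v v) ->
  (forall q c, 0 <= c -> (forall v, b v q <= c * `|v|) -> beta * `|q| <= c) ->
  forall w r c, 0 <= c -> (forall q, b w q = 0) ->
    (forall v, a w v + b v r <= c * `|v|) ->
  let Cs := alpha^-1 + (1 + gamma / alpha) / beta in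
  `|w| <= Cs * c /\ `|r| <= Cs * c.
Proof.
move=> al0 be0 ga0 alin abnd acoer infsup w r c c0 wK res Cs.
have ia0 : 0 < alpha^-1 by rewrite invr_gt0.
have ib0 : 0 < beta^-1 by rewrite invr_gt0.
have wle : `|w| <= alpha^-1 * c.
  have [w_gt0|] := ltP 0 `|w|; last first.
    by move=> /le_trans; apply; rewrite mulr_ge0// ltW.
  rewrite ler_pdivlMl// -(ler_pM2r w_gt0) -mulrA -expr2.
  by rewrite (le_trans (acoer _ wK))// -[leLHS]addr0 -(wK r) res.
have rle : `|r| <= (1 + gamma / alpha) / beta * c.
  rewrite mulrAC ler_pdivlMr// mulrC mulrDl mul1r.
  apply: infsup => [|v].
    by rewrite addr_ge0// mulr_ge0// mulr_ge0// ltW.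
  have -> : b v r = (a w v + b v r) - a w v by rewrite addrAC subrr add0r.
  rewrite mulrDl; apply: lerD => //.
  rewrite -(lformN _ (alin v)) (le_trans (abnd _ _))// normrN ler_wpM2r//.
  by rewrite -mulrA ler_wpM2l.
have ga : 0 <= (1 + gamma / alpha) / beta * c.
  by rewrite !mulr_ge0// ?addr_ge0// ?mulr_ge0// ltW.
have ca : 0 <= alpha^-1 * c by rewrite mulr_ge0// ltW.
by rewrite /Cs mulrDl; split; lra.
Qed.

(** * Weighted energy estimate *)

Section taylor_energy.
Implicit Types nu mu : multi_index.
Context {R : realType} {V Q : normedModType R}.
Variables (A0 : V -> V -> R) (B : nat -> V -> V -> R) (b : V -> Q -> R).
Variables (f : V -> R) (g : Q -> R) (t : multi_index -> V) (tp : multi_index -> Q).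
Variables (alpha beta gamma Md : R) (N : nat -> V -> R) (dd : V -> R).
Hypothesis alpha_gt0 : 0 < alpha.
Hypothesis beta_gt0 : 0 < beta.
Hypothesis gamma_ge0 : 0 <= gamma.
Hypothesis Md_ge0 : 0 <= Md.
Hypothesis A0_lin : forall v, lform (A0 ^~ v).
Hypothesis A0_bnd : forall w v, A0 w v <= gamma * `|w| * `|v|.
Hypothesis B_linl : forall j v, lform (B j ^~ v).
Hypothesis B_linr : forall j w, lform (B j w).
Hypothesis b_linl : forall q, lform (b ^~ q).
Hypothesis b_linr : forall v, lform (b v).
Hypothesis infsup : forall q c, 0 <= c -> (forall v, b v q <= c * `|v|) ->
  beta * `|q| <= c.
Hypothesis rec : forall nu v, A0 (t nu) v + b v (tp nu) =
    (if nu == [fsfun] then f v else 0) -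
    \sum_(j <- finsupp nu) B j (t (mdec nu j)) v.
Hypothesis rec_div : forall nu q, b (t nu) q = if nu == [fsfun] then g q else 0.
Hypothesis young : forall j w v, - B j w v <= 2^-1 * (N j w + N j v).
Hypothesis N_ge0 : forall j v, 0 <= N j v.
Hypothesis dd_bnd : forall v, dd v <= Md * `|v| ^+ 2.
Hypothesis A0_coer : forall v, (forall q, b v q = 0) ->
  alpha * `|v| ^+ 2 + dd v <= A0 v v.

(** The term alpha |t_0|^2 + d(t_0) / 2 of index 0, with d bounded by [Md], divided by alpha. It is
    free of [rho]. *)
Definition energy_bound := (1 + Md / (2 * alpha)) * `|t [fsfun]| ^+ 2.

(** For nonzero nu, (beta |P|)^2 <= 2 (gamma^2 |T|^2 + Md E), and the sum of E is at most [Md] times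
    that of |T|^2. *)
Definition energy_bound_p := `|tp [fsfun]| ^+ 2 +
  2 * (gamma ^+ 2 + Md ^+ 2) / beta ^+ 2 * energy_bound.

Variable rho : nat -> R.
Hypothesis rho_ge0 : forall j, 0 <= rho j.
Hypothesis rho_adm : forall J v, \sum_(j < J) rho j * N j v <= dd v.

Let T nu := multi_pow rho nu *: t nu.
Let P nu := multi_pow rho nu *: tp nu.
Let E nu := \sum_(j <- finsupp nu) rho j * N j (T (mdec nu j)).

Let E_ge0 nu : 0 <= E nu.
Proof. by apply: sumr_ge0 => j _; rewrite mulr_ge0. Qed.

Let dd_ge0 v : 0 <= dd v.
Proof. by have := rho_adm 0 v; rewrite big_ord0. Qed.

Let recT nu v : nu != [fsfun] -> A0 (T nu) v + b v (P nu) =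
  \sum_(j <- finsupp nu) rho j * - B j (T (mdec nu j)) v.
Proof.
move=> nu0; rewrite (lformZ _ (A0_lin v)) (lformZ _ (b_linr v)) -mulrDr rec.
rewrite (negPf nu0) sub0r -sumrN mulr_sumr; apply: eq_big_seq => j.
rewrite finsupp_gt0 => nuj; rewrite (lformZ _ (B_linl j v)).
by rewrite (multi_pow_mdec _ _ _ _ nuj); ring.
Qed.

Let T_ker nu q : nu != [fsfun] -> b (T nu) q = 0.
Proof.
by move=> /negPf nu0; rewrite (lformZ _ (b_linl q)) rec_div nu0 mulr0.
Qed.

Let sum_finsupp_adm nu v : \sum_(j <- finsupp nu) rho j * N j v <= dd v.
Proof.
have [J [n]] := fsub_mbox [fset nu]%fset => /fsubsetP/(_ nu).
rewrite inE eqxx => /(_ isT) nuJ.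
rewrite (sum_finsupp_mbox _ _ _ _ xpredT (fun j => rho j * N j v) nuJ).
apply: le_trans (rho_adm J v); rewrite big_mkcond /=.
by apply: ler_sum => j _; case: ifP => // _; rewrite mulr_ge0.
Qed.

Let sum_E J n : \sum_(nu <- mbox J n) E nu <= \sum_(nu <- mbox J n) dd (T nu).
Proof.
rewrite (sum_sum_mdec _ _ _ xpredT (fun j mu => rho j * N j (T mu))) /=.
apply: ler_sum => mu _; apply: le_trans (rho_adm J _); rewrite big_mkcond /=.
by apply: ler_sum => j _; case: ifP => // _; rewrite mulr_ge0.
Qed.

(** Young's inequality in each direction j; admissibility of [rho] collects the parts that depend on
    v into one d(v). *)
Let source_le nu v :
  \sum_(j <- finsupp nu) rho j * - B j (T (mdec nu j)) v <=
  2^-1 * (E nu + dd v).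
Proof.
apply: (@le_trans _ _ (2^-1 *
    (E nu + \sum_(j <- finsupp nu) rho j * N j v))); last first.
  by rewrite ler_pM2l// lerD2l sum_finsupp_adm.
rewrite /E -big_split /= mulr_sumr; apply: ler_sum => j _.
by rewrite -mulrDr mulrCA ler_wpM2l.
Qed.

Let energy_step nu : alpha * `|T nu| ^+ 2 + 2^-1 * dd (T nu) <=
  2^-1 * E nu +
  (if nu == [fsfun] then alpha * `|T nu| ^+ 2 + 2^-1 * dd (T nu) else 0).
Proof.
case: ifPn => [_|nu0]; first by rewrite lerDr mulr_ge0.
have := A0_coer _ (T_ker _ ^~ nu0).
have := recT _ (T nu) nu0; rewrite T_ker// addr0 => ->.
by have := source_le nu (T nu); lra.
Qed.

Lemma taylor_energy J n : \sum_(nu <- mbox J n)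
  (multi_pow rho nu * `|t nu|) ^+ 2 <= energy_bound.
Proof.
have normT nu : multi_pow rho nu * `|t nu| = `|T nu|.
  by rewrite normrZ ger0_norm// multi_pow_ge0.
under eq_bigr do rewrite normT.
have : \sum_(nu <- mbox J n) (alpha * `|T nu| ^+ 2 + 2^-1 * dd (T nu)) <=
    \sum_(nu <- mbox J n) (2^-1 * E nu + (if nu == [fsfun] then
       alpha * `|T nu| ^+ 2 + 2^-1 * dd (T nu) else 0)).
  by apply: ler_sum => nu _; exact: energy_step.
rewrite big_split [leRHS]big_split /= -!mulr_sumr.
rewrite [X in _ <= _ + X](big_fsetD1 [fsfun] (mbox0 J n)) /= eqxx.
rewrite [X in _ <= _ + (_ + X)]big_seq [X in _ <= _ + (_ + X)]big1; last first.
  by move=> nu; rewrite !inE => /andP[/negPf -> _].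
have := sum_E J n; have := dd_bnd (T [fsfun]).
have -> : T [fsfun] = t [fsfun] by rewrite /T multi_pow0 scale1r.
set S := \sum_(_ <- _) dd _; set X := \sum_(_ <- _) `|_| ^+ 2.
move=> dt0 ES XS; rewrite -(ler_pM2l alpha_gt0) /energy_bound mulrA mulrDr.
have -> : alpha * (Md / (2 * alpha)) = 2^-1 * Md by field; rewrite gt_eqF.
lra.
Qed.

(** The inf-sup condition needs the source term bounded linearly in |v|, whereas Young's inequality
    is quadratic in v. Optimising over multiples of v recovers a Cauchy-Schwarz bound. *)
Lemma taylor_energy_p J n : \sum_(nu <- mbox J n)
  (multi_pow rho nu * `|tp nu|) ^+ 2 <= energy_bound_p.
Proof.
have normT nu : multi_pow rho nu * `|t nu| = `|T nu|.
  by rewrite normrZ ger0_norm// multi_pow_ge0.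
have normP nu : multi_pow rho nu * `|tp nu| = `|P nu|.
  by rewrite normrZ ger0_norm// multi_pow_ge0.
have PE nu : nu != [fsfun] ->
    beta ^+ 2 * `|P nu| ^+ 2 <= 2 * (gamma ^+ 2 * `|T nu| ^+ 2 + Md * E nu).
  move=> nu0; have EM : 0 <= E nu * Md by rewrite mulr_ge0.
  have : beta * `|P nu| <= gamma * `|T nu| + Num.sqrt (E nu * Md).
    apply: infsup => [|v]; first by rewrite addr_ge0// mulr_ge0.
    have -> : b v (P nu) = (A0 (T nu) v + b v (P nu)) - A0 (T nu) v.
      by rewrite addrAC subrr add0r.
    rewrite recT// addrC mulrDl; apply: lerD.
      by rewrite -(lformN _ (A0_lin v)) (le_trans (A0_bnd _ _))// normrN.
    (* The source is linear in v, so [source_le] at s v is a quadratic inequality in s. *)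
    set X := (leLHS); have X2 : X ^+ 2 <= E nu * (Md * `|v| ^+ 2).
      apply: discriminant_le => // [|s]; first by rewrite mulr_ge0// exprn_ge0.
      have := source_le nu (s *: v); have := dd_bnd (s *: v).
      rewrite normrZ exprMn real_normK ?num_real//.
      have -> : \sum_(j <- finsupp nu) rho j * - B j (T (mdec nu j)) (s *: v) =
          s * X.
        rewrite /X mulr_sumr; apply: eq_bigr => j _.
        by rewrite (lformZ _ (B_linr j _)) -mulrN mulrCA.
      by rewrite [Md * (_ * _)]mulrCA; lra.
    rewrite (le_trans (ler_norm _))// -sqrtr_sqr.
    have -> : `|v| = Num.sqrt (`|v| ^+ 2) by rewrite sqrtr_sqr normr_id.
    rewrite -sqrtrM//.
    by apply: ler_wsqrtr; rewrite -mulrA.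
  rewrite -ler_sqr ?nnegrE ?addr_ge0 ?mulr_ge0 ?(ltW beta_gt0)//.
  rewrite exprMn sqrrD sqr_sqrtr// exprMn.
  have := sqr_ge0 (gamma * `|T nu| - Num.sqrt (E nu * Md)).
  rewrite sqrrB sqr_sqrtr// exprMn; move: (gamma * _ * _) => Z; lra.
under eq_bigr do rewrite normP.
rewrite (big_fsetD1 [fsfun] (mbox0 J n)) /=.
rewrite {1}/P multi_pow0 scale1r lerD2l.
rewrite mulrAC ler_pdivlMr ?exprn_gt0// mulrC mulr_sumr.
apply: (@le_trans _ _ (\sum_(nu <- mbox J n)
    2 * (gamma ^+ 2 * `|T nu| ^+ 2 + Md * E nu))).
  apply: (@le_trans _ _ (\sum_(nu <- (mbox J n `\ [fsfun])%fset)
    2 * (gamma ^+ 2 * `|T nu| ^+ 2 + Md * E nu))).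
    rewrite big_seq [leRHS]big_seq; apply: ler_sum => nu.
    by rewrite !inE => /andP[nu0 _]; exact: PE.
  apply: ler_sum_fsub; last exact: fsubD1set.
  by move=> nu; rewrite !(mulr_ge0, addr_ge0)// exprn_ge0.
rewrite -mulr_sumr -[leRHS]mulrA ler_pM2l// big_split /= -!mulr_sumr mulrDl.
have X : \sum_(nu <- mbox J n) `|T nu| ^+ 2 <= energy_bound.
  by have := taylor_energy J n; under eq_bigr do rewrite normT.
apply: lerD; first by rewrite ler_wpM2l// exprn_ge0.
rewrite expr2 -mulrA ler_wpM2l// (le_trans (sum_E J n))//.
apply: (@le_trans _ _ (Md * \sum_(nu <- mbox J n) `|T nu| ^+ 2)).
  by rewrite mulr_sumr; apply: ler_sum => nu _.
by rewrite ler_wpM2l.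
Qed.

End taylor_energy.

(** * Convergence of the Taylor series *)

Section taylor_convergence.
Implicit Types nu mu : multi_index.
Context {R : realType} {V Q : normedModType R}.
Variables (A0 Ay : V -> V -> R) (B : nat -> V -> V -> R) (b : V -> Q -> R).
Variables (Rm : nat -> V -> V -> R) (y : nat -> R).
Variables (f : V -> R) (g : Q -> R) (t : multi_index -> V) (tp : multi_index -> Q).
Variables (M Cs : R) (u : V) (p : Q).
Hypothesis A0_lin : forall v, lform (A0 ^~ v).
Hypothesis Ay_lin : forall v, lform (Ay ^~ v).
Hypothesis B_lin : forall j v, lform (B j ^~ v).
Hypothesis b_linl : forall q, lform (b ^~ q).
Hypothesis b_linr : forall v, lform (b v).
Hypothesis B_bnd : forall j w v, `|B j w v| <= M * `|w| * `|v|.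
Hypothesis M_ge0 : 0 <= M.
Hypothesis Cs_ge0 : 0 <= Cs.
Hypothesis y_cube : cube y.
Hypothesis AyE : forall J w v,
  Ay w v = A0 w v + \sum_(j < J) y j * B j w v + Rm J w v.
Hypothesis Rm_small : forall e, 0 < e -> exists J0, forall J, (J0 <= J)%N ->
  forall w v, `|Rm J w v| <= e * `|w| * `|v|.
Hypothesis stab : forall w r c, 0 <= c -> (forall q, b w q = 0) ->
  (forall v, Ay w v + b v r <= c * `|v|) -> `|w| <= Cs * c /\ `|r| <= Cs * c.
Hypothesis rec : forall nu v, A0 (t nu) v + b v (tp nu) =
    (if nu == [fsfun] then f v else 0) -
    \sum_(j <- finsupp nu) B j (t (mdec nu j)) v.
Hypothesis rec_div : forall nu q, b (t nu) q = if nu == [fsfun] then g q else 0.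
Hypothesis up_sol : forall v, Ay u v + b v p = f v.
Hypothesis up_div : forall q, b u q = g q.
Hypothesis t_sum : bounded_sums (fun nu => `|t nu|).

Let U J n := \sum_(nu <- mbox J n) multi_pow y nu *: t nu.
Let P J n := \sum_(nu <- mbox J n) multi_pow y nu *: tp nu.

Let sum_at0 (F : multi_index -> R) J n :
  (forall nu, nu != [fsfun] -> F nu = 0) ->
  \sum_(nu <- mbox J n) F nu = F [fsfun].
Proof.
move=> F0; rewrite (big_fsetD1 [fsfun] (mbox0 J n)) /= big_seq big1 ?addr0//.
by move=> nu; rewrite !inE => /andP[/F0].
Qed.

Let U_div J n q : b (u - U J n) q = 0.
Proof.
rewrite (lformB _ (b_linl q)) up_div (lform_sum _ (b_linl q)).
rewrite (sum_at0 (fun nu => b (multi_pow y nu *: t nu) q)) => [|nu nu0].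
  by rewrite (lformZ _ (b_linl q)) rec_div eqxx multi_pow0 mul1r subrr.
by rewrite (lformZ _ (b_linl q)) rec_div (negPf nu0) mulr0.
Qed.

(** Summed over the box, the recursion cancels y_j B_j (U, v) except at the indices with mu_j = n,
    whose successor is outside. What else is left is the part of the coefficient not seen by j <
    J. *)
Let residual J n v : Ay (u - U J n) v + b v (p - P J n) =
  - (\sum_(j < J) \sum_(mu <- mbox J n | (n <= mu j)%N)
      y j * (multi_pow y mu * B j (t mu) v)) - Rm J (U J n) v.
Proof.
pose H j mu := y j * (multi_pow y mu * B j (t mu) v).
rewrite (lformB _ (Ay_lin v)) (lformB _ (b_linr v)) addrACA -opprD up_sol (AyE J).
have E1 : A0 (U J n) v + b v (P J n) =
    f v - \sum_(mu <- mbox J n) \sum_(j < J | (mu j < n)%N) H j mu.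
  rewrite -(sum_sum_mdec _ _ _ xpredT) /=.
  rewrite (lform_sum _ (A0_lin v)) (lform_sum _ (b_linr v)) -big_split /=.
  under eq_bigr => nu _ do rewrite (lformZ _ (A0_lin v)) (lformZ _ (b_linr v))
    -mulrDr rec mulrBr.
  rewrite sumrB; congr (_ - _).
    rewrite (sum_at0 (fun nu => _ * _)) => [|nu /negPf ->]; last exact: mulr0.
    by rewrite eqxx multi_pow0 mul1r.
  apply: eq_bigr => nu _; rewrite mulr_sumr; apply: eq_big_seq => j.
  rewrite finsupp_gt0 => nuj.
  by rewrite /H (multi_pow_mdec _ _ _ _ nuj) mulrA.
have E2 : \sum_(j < J) y j * B j (U J n) v =
    \sum_(mu <- mbox J n) \sum_(j < J) H j mu.
  rewrite exchange_big /=; apply: eq_bigr => j _.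
  rewrite (lform_sum _ (B_lin j v)) mulr_sumr; apply: eq_bigr => mu _.
  by rewrite (lformZ _ (B_lin j v)).
have E3 : \sum_(mu <- mbox J n) \sum_(j < J) H j mu =
    \sum_(mu <- mbox J n) \sum_(j < J | (mu j < n)%N) H j mu +
    \sum_(j < J) \sum_(mu <- mbox J n | (n <= mu j)%N) H j mu.
  under [X in _ = _ + X]eq_bigr do rewrite big_mkcond.
  rewrite [X in _ = _ + X]exchange_big -big_split /=; apply: eq_bigr => mu _.
  rewrite (bigID (fun j : 'I_J => (mu j < n)%N)) /=; congr (_ + _).
  by rewrite -big_mkcond /=; apply: eq_bigl => j; rewrite -leqNgt.
rewrite E2 E3 -/(H _ _); lra.
Qed.

Lemma taylor_convergence (e : R) (L0 : {fset multi_index}) : 0 < e ->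
  exists L : {fset multi_index}, [/\ (L0 `<=` L)%fset,
    `|u - \sum_(nu <- L) multi_pow y nu *: t nu| <= e &
    `|p - \sum_(nu <- L) multi_pow y nu *: tp nu| <= e].
Proof.
move=> e0; have [S St] := t_sum.
have S0 : 0 <= S by have := St fset0; rewrite big_seq_fset0.
(* The residual has two parts, each made at most e' |v|; stability multiplies their sum by [Cs]. *)
pose e' := e / (2 * (Cs + 1)).
have e'0 : 0 < e' by rewrite divr_gt0// mulr_gt0// ltr_wpDl.
have S1 : 0 < S + 1 by rewrite ltr_wpDl.
have [J1 RmJ] := Rm_small _ (divr_gt0 e'0 S1).
have [J2 [n2 L0J]] := fsub_mbox L0.
pose J := maxn J1 J2.
have JM : 0 < J%:R * M + 1 :> R by rewrite ltr_wpDl// mulr_ge0.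
have [L1 tail] := bounded_sums_tail _ t_sum _ (divr_gt0 e'0 JM).
have [J3 [n3 L1J]] := fsub_mbox L1.
(* J is fixed before n because the boundary part consists of J sums. With n > n3, no index with mu_j
   >= n belongs to [L1]. *)
pose n := maxn n2 n3.+1.
exists (mbox J n).
have L0L : (L0 `<=` mbox J n)%fset.
  by apply: fsubset_trans L0J _; apply: mbox_sub; rewrite leq_max leqnn ?orbT.
have c0 : 0 <= 2 * e' by rewrite mulr_ge0// ltW.
have : forall v, Ay (u - U J n) v + b v (p - P J n) <= 2 * e' * `|v|.
  move=> v; rewrite residual mulr_natl mulr2n mulrDl; apply: lerD.
    rewrite -sumrN (@le_trans _ _ (\sum_(j < J) M * (e' / (J%:R * M + 1)) * `|v|))//.
      apply: ler_sum => j _.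
      have tailj : \sum_(mu <- mbox J n | (n <= mu j)%N) `|t mu| <=
          e' / (J%:R * M + 1).
        rewrite big_fset_condE; apply: tail => mu; rewrite !inE => /andP[_ nmu].
        apply/negP => /(fsubsetP L1J)/mem_mbox/(_ j).
        have : (n3 < mu j)%N by rewrite (leq_trans _ nmu)// leq_max leqnn orbT.
        by case: ifP => _ lt1 lt2; have := leq_trans lt1 lt2; rewrite ?ltnn.
      apply: (@le_trans _ _ (M * (\sum_(mu <- mbox J n | (n <= mu j)%N) `|t mu|)
          * `|v|)); last by rewrite ler_wpM2r// ler_wpM2l.
      rewrite -sumrN mulr_sumr mulr_suml; apply: ler_sum => mu _.
      rewrite (le_trans (ler_norm _))// normrN !normrM.
      rewrite -[leRHS]mul1r ler_pM// ?mulr_ge0//; first by rewrite ler_norml y_cube.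
      rewrite -[leRHS]mul1r ler_pM//; exact: multi_pow_le1.
    rewrite sumr_const card_ord -[leLHS]mulr_natl mulrA ler_wpM2r//.
    rewrite mulrA mulrCA ler_piMr// ?(ltW e'0)//.
    by rewrite ler_pdivrMr// mul1r lerDl.
  rewrite (le_trans (ler_norm _))// normrN.
  rewrite (le_trans (RmJ _ (leq_maxl _ _) _ _))// ler_wpM2r//.
  have US : `|U J n| <= S.
    apply: le_trans (St (mbox J n)); rewrite (le_trans (ler_norm_sum _ _ _))//.
    apply: ler_sum => nu _; rewrite normrZ ler_piMl//; exact: multi_pow_le1.
  rewrite -[leRHS](divfK (lt0r_neq0 S1)) ler_wpM2l//.
    by rewrite divr_ge0// ltW.
  by rewrite (le_trans US)// lerDl.
move=> /(stab _ _ _ c0 (U_div J n)).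
have Ce : Cs * (2 * e') <= e.
  rewrite /e' mulrA [X in X <= _](_ : _ = e * (Cs / (Cs + 1))); last first.
    by field; rewrite gt_eqF// ltr_wpDl.
  by rewrite ler_piMr ?(ltW e0)// ler_pdivrMr ?ltr_wpDl// mul1r lerDl.
by move=> [/le_trans/(_ Ce) ? /le_trans/(_ Ce) ?].
Qed.

End taylor_convergence.

(** * Best N-term approximation *)

Section largest.
Context {I : choiceType} {R : realType}.

(** If F is positive at some i0 outside [L], only finitely many values reach F(i0) and the largest
    of them is taken; otherwise F vanishes off [L] and any outside index will do. *)
Lemma argmax_outside (F : I -> R) (L : {fset I}) :
  infinite_set [set: I] -> (forall i, 0 <= F i) ->
  (forall e, 0 < e -> finite_set [set i | e <= F i]) ->
  exists2 i, i \notin L & forall j, j \notin L -> F j <= F i.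
Proof.
move=> Iinf F0 Ffin.
have [[i0 i0L F0i]|noF] := pselect (exists2 i, i \notin L & 0 < F i); last first.
  have [i iL] : exists i, i \notin L.
    apply: contrapT => /forallNP h; apply: Iinf.
    apply: (sub_finite_set _ (finite_fset L)) => i _ /=.
    by apply: contrapT => /negP; exact: h.
  exists i => // j jL; rewrite (le_trans _ (F0 i))// leNgt; apply/negP => Fj.
  by apply: noF; exists j.
have finS := Ffin _ F0i.
pose S := [fset i in fset_set [set i | F i0 <= F i] | i \notin L]%fset.
have i0S : i0 \in S by rewrite !inE /= in_fset_set// i0L andbT inE /=.
pose m : S := [arg max_(i > [` i0S]%fset) F (val i)]%O.
exists (val m).
  by have := valP m; rewrite !inE /= => /andP[].
move=> j jL; have [Fj|/ltW Fj] := leP (F i0) (F j).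
  have jS : j \in S by rewrite !inE /= in_fset_set// jL andbT inE /=.
  by rewrite /m; case: arg_maxP => //= k _ /(_ [` jS]%fset isT).
apply: le_trans Fj _.
by rewrite /m; case: arg_maxP => //= k _ /(_ [` i0S]%fset isT).
Qed.

Lemma largest_exists (F : I -> R) :
  infinite_set [set: I] -> (forall i, 0 <= F i) ->
  (forall e, 0 < e -> finite_set [set i | e <= F i]) ->
  forall n, exists L : {fset I}, #|` L| = n /\
    forall i j, i \in L -> j \notin L -> F j <= F i.
Proof.
move=> Iinf F0 Ffin; elim=> [|n [L [Ln LF]]].
  by exists fset0; rewrite cardfs0; split.
have [m mL mF] := argmax_outside _ L Iinf F0 Ffin.
exists (m |` L)%fset; split; first by rewrite cardfsU1 mL Ln.
move=> i j; rewrite !inE => /orP[/eqP ->|iL]; rewrite negb_or => /andP[_ jL].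
  exact: mF.
exact: LF.
Qed.

End largest.

Section stechkin.
Context {I : choiceType} {R : realType}.

(** A value outside [L0] is below N values inside, so F_j^s <= S / N. Then F_j = F_j^s F_j^(1 - s),
    where 1 - s = s r(s). *)
Lemma stechkin (F : I -> R) (s S : R) (N : nat) (L0 L : {fset I}) :
  0 < s < 1 -> (0 < N)%N -> (forall i, 0 <= F i) ->
  (forall L : {fset I}, \sum_(i <- L) F i `^ s <= S) ->
  #|` L0| = N -> (forall i j, i \in L0 -> j \notin L0 -> F j <= F i) ->
  (forall i, i \in L -> i \notin L0) ->
  \sum_(i <- L) F i <= S `^ s^-1 * N%:R `^ (- rate s).
Proof.
move=> /andP[s0 s1] N0 F0 FS L0N L0F LL0.
have S0 : 0 <= S by have := FS fset0; rewrite big_seq_fset0.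
have N0' : 0 < N%:R :> R by rewrite ltr0n.
have r0 : 0 <= rate s by rewrite subr_ge0 invf_ge1// ltW.
have FN j : j \notin L0 -> F j `^ s <= S / N%:R.
  move=> jL0; rewrite ler_pdivlMr// mulr_natr -L0N.
  apply: le_trans (FS L0).
  have -> : F j `^ s *+ #|` L0| = \sum_(i <- L0) F j `^ s.
    by rewrite big_const_seq count_predT iter_addr_0.
  rewrite big_seq [leRHS]big_seq; apply: ler_sum => i iL0.
  by apply: ge0_ler_powR; rewrite ?nnegrE ?(ltW s0)//; exact: L0F.
have FE j : F j = F j `^ s * (F j `^ s) `^ rate s.
  have [->|Fj0] := eqVneq (F j) 0.
    by rewrite powR0 ?gt_eqF// mul0r.
  rewrite -powRrM -powRD; last by rewrite Fj0 implybT.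
  rewrite /rate mulrBr mulr1 divff ?gt_eqF// addrC subrK powRr1//.
apply: (@le_trans _ _ (\sum_(i <- L) F i `^ s * (S / N%:R) `^ rate s)).
  rewrite big_seq [leRHS]big_seq; apply: ler_sum => i iL.
  rewrite [leLHS]FE ler_wpM2l ?powR_ge0//.
  apply: ge0_ler_powR; rewrite ?nnegrE ?powR_ge0 ?divr_ge0//.
  exact/FN/LL0.
rewrite -mulr_suml (le_trans (ler_wpM2r (powR_ge0 _ _) (FS L)))//.
rewrite powRM ?invr_ge0// mulrA powRN -powR_inv1//.
rewrite -powRrM mulN1r -powRN ler_wpM2r ?powR_ge0//.
have [->|S_neq0] := eqVneq S 0; first by rewrite mul0r powR_ge0.
rewrite -{1}[S]powRr1// -powRD ?S_neq0 ?implybT//.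
by rewrite /rate addrC subrK.
Qed.

End stechkin.

(** * Summability of the coefficients *)

Section powR_extra.
Context {R : realType}.

Lemma powRK (x s : R) : 0 <= x -> s != 0 -> (x `^ s^-1) `^ s = x.
Proof. by move=> x0 s0; rewrite -powRrM mulVf// powRr1. Qed.

(** For z in [0, 1] one has z <= z^s; this is applied to the two fractions of x + y. *)
Lemma powR_subadd (s x y : R) : 0 < s <= 1 -> 0 <= x -> 0 <= y ->
  (x + y) `^ s <= x `^ s + y `^ s.
Proof.
move=> /andP[s0 s1] x0 y0; have [->|x_neq0] := eqVneq x 0.
  by rewrite add0r lerDr powR_ge0.
have S0 : 0 < x + y by rewrite ltr_wpDr// lt_def x_neq0.
have frac z : 0 <= z -> z <= x + y -> z / (x + y) * (x + y) `^ s <= z `^ s.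
  move=> z0 zS; have [->|z_neq0] := eqVneq z 0; first by rewrite !mul0r powR_ge0.
  have zgt0 : 0 < z by rewrite lt_def z_neq0.
  rewrite -[in leRHS](divfK (lt0r_neq0 S0) z) powRM ?divr_ge0 ?(ltW S0)//.
  rewrite ler_wpM2r ?powR_ge0// ger1_powR// divr_gt0//=.
  by rewrite ler_pdivrMr// mul1r.
have -> : (x + y) `^ s = x / (x + y) * (x + y) `^ s + y / (x + y) * (x + y) `^ s.
  by rewrite -!mulrDl divff ?mul1r// gt_eqF.
by apply: lerD; apply: frac; rewrite ?lerDl ?lerDr.
Qed.

Lemma powR_sum_le (s : R) (I : Type) (r : seq I) (P : pred I) (F : I -> R) :
  0 < s <= 1 -> (forall i, 0 <= F i) ->
  (\sum_(i <- r | P i) F i) `^ s <= \sum_(i <- r | P i) F i `^ s.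
Proof.
move=> s01 F0; have /andP[s0 _] := s01.
elim: r => [|i r IHr]; first by rewrite !big_nil powR0// gt_eqF.
rewrite !big_cons; case: ifP => // _.
by rewrite (le_trans (powR_subadd _ _ _ s01 _ _))// ?sumr_ge0// lerD2l.
Qed.

Lemma multi_pow_powR (y : nat -> R) (s : R) (nu : multi_index) :
  (forall j, 0 <= y j) ->
  (multi_pow y nu) `^ s = multi_pow (fun j => y j `^ s) nu.
Proof.
move=> y0; rewrite /multi_pow.
elim: (enum_fset (finsupp nu)) => [|j r IHr]; first by rewrite !big_nil powR1.
rewrite !big_cons powRM ?exprn_ge0 ?prodr_ge0// => [|i _]; last first.
  exact: exprn_ge0.
rewrite IHr; congr (_ * _).
by elim: (nu j) => [|n IHn]; rewrite ?powR1// !exprS powRM ?exprn_ge0// IHn.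
Qed.

Lemma multi_powM (y z : nat -> R) (nu : multi_index) :
  multi_pow y nu * multi_pow z nu = multi_pow (fun j => y j * z j) nu.
Proof.
by rewrite /multi_pow -big_split; apply: eq_bigr => j _; rewrite exprMn.
Qed.

End powR_extra.

Section ell.
Context {R : realType} {I : choiceType}.

Lemma in_ellP (s : R) (th : I -> R) : 0 < s ->
  in_ell s th <->
  exists C, forall L : {fset I}, \sum_(i <- L) `|th i| `^ s <= C.
Proof.
move=> s0; rewrite /in_ell /lnorm; split.
  move=> /lty_poweRy; rewrite invr_eq0 gt_eqF// => /(_ isT).
  set E := esum _ _ => E_lt.
  have E0 : (0 <= E)%E by apply: esum_ge0 => i _; rewrite lee_fin powR_ge0.
  exists (fine E) => L; rewrite -lee_fin fineK ?ge0_fin_numE//.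
  apply: esum_ge; exists [set` L]; first by split.
  by rewrite fsbig_finite//= set_fsetK -sumEFin.
move=> [C thC]; apply: poweR_lty; apply: (@le_lt_trans _ _ C%:E); last exact: ltry.
apply: ge_ereal_sup => _ [X [Xfin _] <-].
by rewrite fsbig_finite//= sumEFin lee_fin.
Qed.

Lemma lnormE (s : R) (th : I -> R) : 0 < s -> in_ell s th ->
  exists S, [/\ 0 <= S, lnorm s th = (S `^ s^-1)%:E &
    forall L : {fset I}, \sum_(i <- L) `|th i| `^ s <= S].
Proof.
move=> s0; rewrite /in_ell /lnorm.
move=> /lty_poweRy; rewrite invr_eq0 gt_eqF// => /(_ isT).
set E := esum _ _ => E_lt.
have E0 : (0 <= E)%E by apply: esum_ge0 => i _; rewrite lee_fin powR_ge0.
have Efin : E \is a fin_num by rewrite ge0_fin_numE.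
exists (fine E); split; first exact: fine_ge0.
  by rewrite -[in LHS](fineK Efin) poweR_EFin.
move=> L; rewrite -lee_fin fineK//.
apply: esum_ge; exists [set` L]; first by split.
by rewrite fsbig_finite//= set_fsetK -sumEFin.
Qed.

End ell.

Section summability.
Context {R : realType}.
Implicit Types nu mu : multi_index.

Definition bounded_partial_sums (c : nat -> R) :=
  exists C, forall J, \sum_(j < J) c j <= C.

Lemma bounded_partial_sums_tail (c : nat -> R) : (forall j, 0 <= c j) ->
  bounded_partial_sums c -> forall e, 0 < e ->
  exists J0, forall J, \sum_(j < J | (J0 <= j)%N) c j <= e.
Proof.
move=> c0 [C cC] e e0.
pose S := [set \sum_(j < J) c j | J in [set: nat]].
have supS : has_sup S.
  by split; [exists (\sum_(j < 0) c j), 0%N|exists C => _ [J _ <-]].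
have [_ [J0 _ <-] J0S] := sup_adherent e0 supS.
exists J0 => J; have [JJ0|J0J] := leqP J J0.
  by rewrite big1 ?ltW// => j; rewrite leqNgt (leq_trans (ltn_ord j) JJ0).
have : \sum_(j < J) c j <= sup S by apply: (ub_le_sup (proj2 supS)); exists J.
rewrite (bigID (fun j : 'I_J => (j < J0)%N)) /= -(big_ord_widen _ c (ltnW J0J)).
under [X in _ + X <= _]eq_bigl do rewrite -leqNgt.
lra.
Qed.

Lemma in_ell_partial_sums (s : R) (th : nat -> R) : 0 < s -> in_ell s th ->
  bounded_partial_sums (fun j => `|th j| `^ s).
Proof.
move=> s0 /(in_ellP _ _ s0)[C thC]; exists C => J.
have -> : \sum_(j < J) `|th j| `^ s =
    \sum_(j <- [fset j | j in iota 0 J]%fset) `|th j| `^ s; last exact: thC.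
rewrite -(big_mkord xpredT (fun j => `|th j| `^ s)); apply: perm_big.
apply: uniq_perm; rewrite ?iota_uniq ?fset_uniq// => j.
by rewrite /index_iota subn0 !inE.
Qed.

Lemma bounded_partial_sums_powR (s : R) (c : nat -> R) : 0 < s <= 1 ->
  (forall j, 0 <= c j) -> bounded_partial_sums (fun j => c j `^ s) ->
  bounded_partial_sums c.
Proof.
move=> s01 c0 [C cC]; have /andP[s0 _] := s01; exists (C `^ s^-1) => J.
have S0 : 0 <= \sum_(j < J) c j by exact: sumr_ge0.
rewrite -[leLHS]powRr1// -(mulfV (lt0r_neq0 s0)) powRrM.
apply: ge0_ler_powR; rewrite ?nnegrE ?invr_ge0 ?powR_ge0 ?(ltW s0)//.
  by apply: le_trans (cC 0%N); rewrite big_ord0.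
apply: le_trans (cC J); exact: powR_sum_le.
Qed.

Lemma bounded_sums_powR (s : R) (x : multi_index -> R) : 0 < s <= 1 ->
  (forall nu, 0 <= x nu) -> bounded_sums (fun nu => x nu `^ s) ->
  bounded_sums x.
Proof.
move=> s01 x0 [C xC]; have /andP[s0 _] := s01; exists (C `^ s^-1) => L.
have S0 : 0 <= \sum_(nu <- L) x nu by exact: sumr_ge0.
rewrite -[leLHS]powRr1// -(mulfV (lt0r_neq0 s0)) powRrM.
apply: ge0_ler_powR; rewrite ?nnegrE ?invr_ge0 ?powR_ge0 ?(ltW s0)//.
  by have := xC fset0; rewrite big_seq_fset0.
apply: le_trans (xC L); exact: powR_sum_le.
Qed.

Lemma ler_sum_finsupp nu (P : pred nat) (F : nat -> R) j : (0 < nu j)%N -> P j ->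
  (forall i, 0 <= F i) -> F j <= \sum_(i <- finsupp nu | P i) F i.
Proof.
move=> nuj Pj F0; rewrite big_mkcond (big_fsetD1 j) ?finsupp_gt0//= Pj.
by rewrite lerDl sumr_ge0// => i _; case: ifP.
Qed.

(** The value would be the product of the geometric series 1 / (1 - c_j); the recursion c^nu = c_j
    c^(nu - e_j) bounds it without an infinite product. *)
Lemma bounded_sums_multi_pow (c : nat -> R) : (forall j, 0 <= c j < 1) ->
  bounded_partial_sums c -> bounded_sums (multi_pow c).
Proof.
move=> c01 csum; have c0 j : 0 <= c j by have /andP[] := c01 j.
have half_gt0 : 0 < 2^-1 :> R by rewrite invr_gt0.
have [J0 cJ0] := bounded_partial_sums_tail _ c0 csum _ half_gt0.
have pow0 nu : 0 <= multi_pow c nu by exact: multi_pow_ge0.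
have [q q01 cq] : exists2 q, 0 <= q < 1 & forall j, (j < J0)%N -> c j <= q.
  elim: J0 {cJ0} => [|J0 [q /andP[q0 q1] cq]].
    by exists 0; rewrite ?lexx ?ltr01.
  exists (Num.max q (c J0)).
    by rewrite le_max q0 gt_max q1; have /andP[] := c01 J0.
  by move=> j; rewrite ltnS leq_eqVlt le_max => /orP[/eqP ->|/cq ->//]; rewrite lexx orbT.
apply: (bounded_sums_rec _ c q J0) => // nu j.
  by move=> jJ0 nuj; rewrite (multi_pow_mdec _ _ _ _ nuj) ler_wpM2r// cq.
move=> J0j nuj; rewrite (multi_pow_mdec _ _ _ _ nuj).
apply: (ler_sum_finsupp _ _ (fun i => c i * multi_pow c (mdec nu i))) => //.
by move=> i; rewrite mulr_ge0.
Qed.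

(** Write x = (rho^nu x) rho^(-nu). Exponent t uses only that the first factor is bounded. Exponent
    s uses its square-summability: 1/s = 1/2 + 1/t, and Young's inequality has conjugate exponents
    2/s and t/s. *)
Lemma powR_bounded_sums_of_weighted (rho : nat -> R) (x : multi_index -> R)
    (t : R) : (forall j, 1 < rho j) -> 0 < t ->
  bounded_partial_sums (fun j => (rho j)^-1 `^ t) -> (forall nu, 0 <= x nu) ->
  bounded_sums (fun nu => (multi_pow rho nu * x nu) ^+ 2) ->
  bounded_sums (fun nu => x nu `^ t) /\
  bounded_sums (fun nu => x nu `^ (2 * t / (2 + t))).
Proof.
move=> rho1 t0 rhot x0 [C xC].
have rho0 j : 0 < rho j := lt_trans ltr01 (rho1 j).
have pow0 nu : 0 < multi_pow rho nu.
  by apply: prodr_gt0 => j _; exact: exprn_gt0.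
have ipow0 nu : 0 < multi_pow (fun j => (rho j)^-1) nu.
  by apply: prodr_gt0 => j _; rewrite exprn_gt0// invr_gt0.
have powK nu : multi_pow (fun j => (rho j)^-1) nu * multi_pow rho nu = 1.
  rewrite multi_powM /multi_pow big1// => j _.
  by rewrite mulVf ?expr1n// gt_eqF.
have xE nu : x nu = (multi_pow rho nu * x nu) * multi_pow (fun j => (rho j)^-1) nu.
  by rewrite mulrC mulrA powK mul1r.
have sumt : bounded_sums (fun nu => multi_pow (fun j => (rho j)^-1) nu `^ t).
  have [C' sC'] : bounded_sums (multi_pow (fun j => (rho j)^-1 `^ t)).
    apply: bounded_sums_multi_pow => // j; rewrite powR_ge0 /=.
    rewrite [ltRHS](_ : 1 = 1 `^ t); last by rewrite powR1.
    by rewrite gt0_ltr_powR ?nnegrE ?invr_ge0 ?(ltW (rho0 j))// invf_lt1.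
  exists C' => L; rewrite (eq_bigr (multi_pow (fun j => (rho j)^-1 `^ t))) => [|nu _].
    exact: sC'.
  by rewrite multi_pow_powR// => j; rewrite invr_ge0 ltW.
split.
  have wx0 nu : 0 <= multi_pow rho nu * x nu by rewrite mulr_ge0// ltW.
  have x_bnd nu : multi_pow rho nu * x nu <= Num.sqrt C.
    have := xC [fset nu]%fset; rewrite big_seq_fset1 => /ler_wsqrtr.
    by rewrite sqrtr_sqr ger0_norm.
  apply: (@bounded_sums_le _ _
    (fun nu => Num.sqrt C `^ t * multi_pow (fun j => (rho j)^-1) nu `^ t)).
    move=> nu; rewrite -powRM ?sqrtr_ge0 ?(ltW (ipow0 nu))//.
    apply: ge0_ler_powR; rewrite ?nnegrE ?(ltW t0)//.
      by rewrite mulr_ge0 ?sqrtr_ge0// ltW.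
    by rewrite [leLHS]xE ler_wpM2r// ltW.
  exact/bounded_sumsZ/sumt/powR_ge0.
have t2 : 0 < 2 + t by rewrite addr_gt0.
pose s := 2 * t / (2 + t).
have s0 : 0 < s by rewrite divr_gt0// mulr_gt0.
apply: (@bounded_sums_le _ _ (fun nu =>
  (2 / s)^-1 * (multi_pow rho nu * x nu) ^+ 2 +
  (t / s)^-1 * multi_pow (fun j => (rho j)^-1) nu `^ t)).
  move=> nu; rewrite {1}xE powRM ?mulr_ge0 ?(ltW (pow0 nu)) ?(ltW (ipow0 nu))//.
  have := @conjugate_powR R ((multi_pow rho nu * x nu) `^ s)
     (multi_pow (fun j => (rho j)^-1) nu `^ s) (2 / s) (t / s).
  move=> /(_ (powR_ge0 _ _) (powR_ge0 _ _)).
  move=> /(_ (divr_gt0 (ltr0n _ 2) s0) (divr_gt0 t0 s0)).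
  have E : (2 / s)^-1 + (t / s)^-1 = 1.
    by rewrite /s; field; rewrite !gt_eqF.
  move=> /(_ E); rewrite -!powRrM.
  have -> : s * (2 / s) = 2%:R by field; rewrite gt_eqF.
  have -> : s * (t / s) = t by field; rewrite gt_eqF.
  by rewrite powR_mulrn ?mulr_ge0 ?(ltW (pow0 nu))// ![_ / (_ / s)]mulrC.
apply: bounded_sumsD; apply: bounded_sumsZ => //.
- by rewrite invr_ge0 divr_ge0// ltW.
- by exists C.
- by rewrite invr_ge0 divr_ge0// ltW.
Qed.

Lemma ler_sum_ord (P : pred nat) (F : nat -> R) J J' : (forall j, 0 <= F j) ->
  (J <= J')%N -> \sum_(j < J | P j) F j <= \sum_(j < J' | P j) F j.
Proof.
move=> F0 JJ'; rewrite (big_ord_widen_cond _ P F JJ').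
rewrite [leRHS](bigID (fun j : 'I_J' => (j < J)%N)) /=.
by rewrite lerDl sumr_ge0.
Qed.

Lemma ler_sum_ord_finsupp nu (P : pred nat) J :
  (\sum_(j < J | P j) (nu j)%:R : R) <= \sum_(j <- finsupp nu | P j) (nu j)%:R.
Proof.
have [J' [n]] := fsub_mbox [fset nu]%fset => /fsubsetP/(_ nu).
rewrite inE eqxx => /(_ isT) nuJ.
have nuJ' : nu \in mbox (maxn J J') n.
  exact: (fsubsetP (mbox_sub _ _ _ _ (leq_maxr _ _) (leqnn _))).
rewrite (sum_finsupp_mbox _ _ _ _ P (fun j => (nu j)%:R : R) nuJ').
apply: le_trans (ler_sum_ord _ (fun j => (nu j)%:R) _ _ _ (leq_maxl J J')) _ => //.
rewrite [leRHS]big_mkcondr /=; apply: ler_sum => j _.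
by case: ifPn => //; rewrite -leqNgt leqn0 => /eqP ->.
Qed.

(** That is (n / e)^n <= n!, from a single term of the series of exp(n); for n = 0 the power is 1
    whatever its base. *)
Lemma expRn_fact (n : nat) : 1 <= (expR 1 / n%:R) ^+ n * n`!%:R :> R.
Proof.
case: n => [|n]; first by rewrite expr0 mul1r.
have n0 : 0 < n.+1%:R ^+ n.+1 :> R by rewrite exprn_gt0.
rewrite expr_div_n mulrAC ler_pdivlMr// mul1r -ler_pdivrMr ?ltr0n ?fact_gt0//.
rewrite -expRM_natl mulr1 (le_trans _ (expR_ge1Dxn n _))// lerDr//.
Qed.

Lemma fact_le_expn (n : nat) : (n`! <= n ^ n)%N.
Proof.
have -> : (n ^ n = \prod_(1 <= i < n.+1) n)%N by rewrite prod_nat_const_nat subn1.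
rewrite fact_prod big_nat [leqRHS]big_nat.
by apply: leq_prod => i /andP[_]; rewrite ltnS.
Qed.

End summability.

(** * Summability from weights adapted to each index *)

Section summability_of_admissible_weights.
Context {R : realType}.
Implicit Types nu mu : multi_index.
Variables (s eta C : R) (b : nat -> R) (x : multi_index -> R).
Hypothesis s01 : 0 < s < 1.
Hypothesis eta_gt0 : 0 < eta.
Hypothesis b_ge0 : forall j, 0 <= b j.
Hypothesis b_sum : bounded_partial_sums (fun j => b j `^ s).
Hypothesis x_ge0 : forall nu, 0 <= x nu.
Hypothesis weighted_bound : forall rho : nat -> R, (forall j, 1 <= rho j) ->
  (forall J, \sum_(j < J) (rho j - 1) * b j <= eta) ->
  forall nu, multi_pow rho nu * x nu <= C.

Let s_gt0 : 0 < s. Proof. by case/andP: s01. Qed.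
Let s_le1 : 0 < s <= 1. Proof. by case/andP: s01 => -> /ltW ->. Qed.

(* Summable and positive, so that one may divide by [b' j] even when [b j = 0]. *)
Let w (j : nat) : R := (2^-1 ^+ j.+1) `^ s^-1.
Let b' j := b j + w j.

Let w_gt0 j : 0 < w j.
Proof. by rewrite powR_gt0// exprn_gt0. Qed.

Let b'_gt0 j : 0 < b' j.
Proof. by rewrite ltr_wpDl. Qed.

Let b_le j : b j <= b' j.
Proof. by rewrite lerDl ltW. Qed.

(** The factor e comes from (n / e)^n <= n!, and 2 / eta from granting half of the margin eta to the
    variables j >= J0. *)
Let K : R := 2 * expR 1 / eta.
Let d j := K * b' j.

Let K_gt0 : 0 < K.
Proof. by rewrite divr_gt0// mulr_gt0// expR_gt0. Qed.

Let d_ge0 j : 0 <= d j.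
Proof. by rewrite ltW// mulr_gt0. Qed.

Let d_sum : bounded_partial_sums (fun j => d j `^ s).
Proof.
have [C' bC] := b_sum; exists (K `^ s * (C' + 1)) => J.
under eq_bigr do rewrite powRM ?(ltW K_gt0) ?(ltW (b'_gt0 _))//.
rewrite -mulr_sumr ler_wpM2l ?powR_ge0//.
apply: (@le_trans _ _ (\sum_(j < J) (b j `^ s + 2^-1 ^+ j.+1))).
  apply: ler_sum => j _; rewrite (le_trans (powR_subadd _ _ _ s_le1 _ _))//.
    by rewrite ltW.
  by rewrite lerD2l /w powRK ?exprn_ge0// gt_eqF.
rewrite big_split lerD//=; first exact: bC.
suff -> : \sum_(j < J) (2^-1 : R) ^+ j.+1 = 1 - 2^-1 ^+ J.
  by rewrite gerBl exprn_ge0.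
elim: J => [|J IHJ]; first by rewrite big_ord0 expr0 subrr.
by rewrite big_ord_recr IHJ /= exprS; lra.
Qed.

Lemma summable_of_admissible_weights : bounded_sums (fun nu => x nu `^ s).
Proof.
have half_gt0 : 0 < 2^-1 :> R by rewrite invr_gt0.
have [J0 dJ0] := bounded_partial_sums_tail _ (fun j => powR_ge0 _ _) d_sum _ half_gt0.
(* The variables j < J0 share the other half of the margin: [eta1 * S0] is eta / 2. The summand 1
   keeps S0 positive when J0 = 0. *)
pose S0 := 1 + \sum_(j < J0) b' j.
have S0_gt0 : 0 < S0 by rewrite ltr_wpDr// sumr_ge0// => j _; exact: ltW.
pose eta1 := eta / 2 / S0.
have eta1_gt0 : 0 < eta1 by rewrite !divr_gt0.
pose q := (1 + eta1)^-1.
have q_gt0 : 0 < q by rewrite invr_gt0 addr_gt0.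
pose gg j := if (j < J0)%N then q else d j.
pose deg nu := (\sum_(j <- finsupp nu) if (j < J0)%N then 0 else nu j)%N.
pose G j m := gg j ^+ m / (if (j < J0)%N then 1 else m`!%:R).
(* With n the total degree of nu in the variables j >= J0, this is
     q^|nu_head| * n! / nu_tail! * d^nu_tail,
   a majorant of the coefficients (up to C) which satisfies the recursion of
   [bounded_sums_rec], even after raising it to the power s <= 1. *)
pose F nu := \prod_(j <- finsupp nu) G j (nu j) * (deg nu)`!%:R.
have G_ge0 j m : 0 <= G j m.
  by rewrite /G /gg; case: ifP => _; rewrite divr_ge0 ?exprn_ge0// ltW.
have F_ge0 nu : 0 <= F nu by rewrite mulr_ge0 ?prodr_ge0.
have G0 j : G j 0%N = 1 by rewrite /G expr0; case: ifP; rewrite divr1.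
have degE nu j : (0 < nu j)%N ->
    deg nu = (deg (mdec nu j) + (J0 <= j))%N.
  move=> nuj; rewrite /deg.
  have [|c [-> ->]] := @big_mdec nat 0%N addn
    (fun j m => if (j < J0)%N then 0%N else m) nu j _ nuj.
    by move=> i; case: ifP.
  rewrite (leqNgt J0); case: (j < J0)%N => /=; first by rewrite addn0.
  by rewrite addn1 -addSn prednK.
have G_head j m : (j < J0)%N -> (0 < m)%N -> G j m = q * G j m.-1.
  by case: m => // m jJ0 _; rewrite /G /gg jJ0 exprS -mulrA.
have G_tail j m : (J0 <= j)%N -> (0 < m)%N -> m%:R * G j m = d j * G j m.-1.
  case: m => // m J0j _; rewrite /G /gg ltnNge J0j /= exprS factS natrM invfM.
  by rewrite mulrACA [LHS]mulrA [m.+1%:R * _]mulrCA mulfV ?mulr1// pnatr_eq0.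
have Fhead nu j : (j < J0)%N -> (0 < nu j)%N -> F nu = q * F (mdec nu j).
  move=> jJ0 nuj; rewrite /F (degE _ _ nuj) (leqNgt J0) jJ0 addn0.
  have [c [-> ->]] := prod_mdec _ G nu j G0 nuj.
  by rewrite G_head// !mulrA.
have degR nu :
    (deg nu)%:R = \sum_(i <- finsupp nu | (J0 <= i)%N) (nu i)%:R :> R.
  rewrite [RHS]big_mkcond natr_sum; apply: eq_bigr => i _ /=.
  by rewrite (leqNgt J0); case: (i < J0)%N.
(* The multinomial recursion: one factor n of n! is split as the sum of the nu_i over i >= J0. *)
have Ftail nu j : (J0 <= j)%N -> (0 < nu j)%N ->
    F nu = \sum_(i <- finsupp nu | (J0 <= i)%N) d i * F (mdec nu i).
  move=> J0j nuj; rewrite {1}/F.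
  have degS : (deg nu) = (deg nu).-1.+1 by rewrite (degE _ _ nuj) J0j addn1.
  rewrite degS factS -degS natrM mulrA degR.
  rewrite mulr_sumr mulr_suml big_seq_cond [RHS]big_seq_cond.
  apply: eq_bigr => i /andP[]; rewrite finsupp_gt0 => nui J0i.
  rewrite /F (degE _ _ nui) J0i addn1 /=.
  have [c [-> ->]] := prod_mdec _ G nu i G0 nui.
  by rewrite [_ * (nu i)%:R]mulrC mulrA G_tail// !mulrA.
have xF nu : x nu <= C * F nu.
  (* If nu has no variable j >= J0, the quotient by [deg nu] is 0 by convention and the weight is 1
     there. *)
  pose rho j := if (j < J0)%N then 1 + eta1 else
    1 + eta / 2 * ((nu j)%:R / (deg nu)%:R) / b' j.
  have rho1 j : 1 <= rho j.
    rewrite /rho; case: ifP => _; rewrite lerDl; first exact: ltW.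
    rewrite mulr_ge0 ?invr_ge0 ?(ltW (b'_gt0 j))//.
    by rewrite mulr_ge0 ?divr_ge0// ltW.
  have rhoE J : \sum_(j < J) (rho j - 1) * b j <= eta.
    rewrite (bigID (fun j : 'I_J => (j < J0)%N)) /= [leRHS]splitr.
    apply: lerD.
      apply: (@le_trans _ _ (\sum_(j < J | (j < J0)%N) eta1 * b' j)).
        apply: ler_sum => j jJ0; rewrite /rho jJ0 addrC addKr.
        by rewrite ler_wpM2l// ltW.
      rewrite -mulr_sumr (@le_trans _ _ (eta1 * S0))//; last first.
        by rewrite divfK// gt_eqF.
      rewrite ler_wpM2l ?(ltW eta1_gt0)// /S0.
      have b'0 j : 0 <= b' j by rewrite ltW.
      have := ler_sum_ord (fun j => (j < J0)%N) b' _ _ b'0 (leq_maxl J J0).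
      rewrite -(big_ord_widen _ b' (leq_maxr J J0)).
      by move=> /le_trans; apply; rewrite lerDr.
    apply: (@le_trans _ _ (\sum_(j < J | (J0 <= j)%N)
        eta / 2 * ((nu j)%:R / (deg nu)%:R))).
      under eq_bigl do rewrite -leqNgt.
      apply: ler_sum => j J0j; rewrite /rho ltnNge J0j /= addrC addKr.
      rewrite -mulrA ler_piMr ?mulr_ge0 ?invr_ge0 ?(ltW eta_gt0)//.
      by rewrite mulrC ler_pdivrMr// mul1r.
    rewrite -mulr_sumr ler_piMr ?divr_ge0 ?(ltW eta_gt0)// -mulr_suml.
    have [->|deg0] := eqVneq (deg nu) 0%N; first by rewrite invr0 mulr0.
    rewrite ler_pdivrMr ?ltr0n ?lt0n// mul1r degR.
    exact: ler_sum_ord_finsupp.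
  have rhoC := weighted_bound _ rho1 rhoE nu.
  (* Reduces to (e / n)^n n! >= 1 and nu_j! <= nu_j^nu_j. *)
  have rhoF : 1 <= multi_pow rho nu * F nu.
    rewrite /F mulrA /multi_pow -big_split /=.
    apply: le_trans (expRn_fact (deg nu)) _; rewrite ler_wpM2r//.
    rewrite expr_sum; apply: ler_prod => j _; apply/andP; split.
      by rewrite exprn_ge0// divr_ge0// expR_ge0.
    have rho0 : 0 <= rho j by rewrite (le_trans ler01).
    rewrite /G mulrA -exprMn.
    case: ifPn => [jJ0|J0j].
      by rewrite divr1 /rho /gg jJ0 divff ?expr1n ?expr0// gt_eqF// addr_gt0.
    have n0 : 0 < (nu j)`!%:R :> R by rewrite ltr0n fact_gt0.
    rewrite ler_pdivlMr//.
    apply: (@le_trans _ _ ((expR 1 / (deg nu)%:R) ^+ nu j * (nu j)%:R ^+ nu j)).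
      rewrite ler_wpM2l ?exprn_ge0 ?divr_ge0 ?expR_ge0//.
      by rewrite -natrX ler_nat fact_le_expn.
    rewrite -exprMn lerXn2r ?nnegrE ?mulr_ge0 ?invr_ge0 ?expR_ge0//.
      by rewrite /gg (negPf J0j).
    rewrite /rho /gg (negPf J0j) mulrDl.
    rewrite (_ : eta / 2 * _ / _ * _ = expR 1 / (deg nu)%:R * (nu j)%:R).
      by rewrite lerDr mul1r.
    rewrite /d /K; move: ((deg nu)%:R^-1) => z; field.
    by rewrite !gt_eqF.
  apply: le_trans (ler_wpM2r (F_ge0 nu) rhoC); rewrite mulrAC.
  by rewrite ler_peMl.
have C_ge0 : 0 <= C.
  have := xF [fsfun]; rewrite /F /deg finsupp0 !big_nil mul1r fact0 mulr1.
  exact: le_trans.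
apply: (@bounded_sums_le _ _ (fun nu => C `^ s * F nu `^ s)).
  move=> nu; rewrite -powRM//; apply: ge0_ler_powR (xF nu).
  - exact: ltW.
  - by rewrite nnegrE.
  - by rewrite nnegrE mulr_ge0.
apply: bounded_sumsZ; first exact: powR_ge0.
apply: (bounded_sums_rec _ (fun j => d j `^ s) (q `^ s) J0).
- by move=> nu; exact: powR_ge0.
- rewrite powR_ge0 /= [ltRHS](_ : 1 = 1 `^ s); last by rewrite powR1.
  rewrite gt0_ltr_powR ?nnegrE ?(ltW q_gt0)//.
  by rewrite invf_lt1 ?addr_gt0// ltrDl.
- by move=> j; exact: powR_ge0.
- exact: dJ0.
- by move=> nu j jJ0 nuj; rewrite (Fhead _ _ jJ0 nuj) powRM// ltW.
move=> nu j J0j nuj; rewrite (Ftail _ _ J0j nuj).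
rewrite (le_trans (powR_sum_le _ _ _ _ _ s_le1 _))//.
  by move=> i; rewrite mulr_ge0.
by apply: ler_sum => i _; rewrite powRM.
Qed.

End summability_of_admissible_weights.

(** * Coefficients in L^oo and the affine parametrization *)

Section Linfty_theory.
Context {R : realType} {d : nat} {D : set 'rV[R]_d} (oD : open D).
Implicit Types k l : 'rV[R]_d -> R.

(** [lebesgue_on] charges only [D], so the complement of [D] is a null set. *)
Lemma ae_on (P : 'rV[R]_d -> Prop) : (forall x, D x -> P x) ->
  \forall x \ae lebesgue_on oD, P x.
Proof.
move=> DP; exists (~` D); split.
- by apply: measurableC; exact: measurable_open_rV.
- by rewrite /lebesgue_on /= /mrestr setICl measure0.
- by move=> x /= nPx Dx; apply: nPx; exact: DP.
Qed.

Let ae_filter : Filter (almost_everywhere (lebesgue_on oD)).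
Proof. exact: ae_filter_ringOfSetsType. Qed.

Lemma aeS (P P' : 'rV[R]_d -> Prop) : (forall x, P x -> P' x) ->
  (\forall x \ae lebesgue_on oD, P x) -> \forall x \ae lebesgue_on oD, P' x.
Proof. by move=> PP'; exact: (@filterS _ _ ae_filter). Qed.

Lemma aeS2 (P P' P'' : 'rV[R]_d -> Prop) : (forall x, P x -> P' x -> P'' x) ->
  (\forall x \ae lebesgue_on oD, P x) -> (\forall x \ae lebesgue_on oD, P' x) ->
  \forall x \ae lebesgue_on oD, P'' x.
Proof. by move=> PP'; exact: (@filterS2 _ _ ae_filter). Qed.

Lemma LinftyP k : Linfty oD k <->
  measurable_fun (D : set (borel_rV R d)) (k : borel_rV R d -> R) /\
  exists M, \forall x \ae lebesgue_on oD, `|k x| <= M.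
Proof.
split=> -[mk bk]; split => //.
  have H := ess_sup_ge (lebesgue_on oD) (fun x : borel_rV R d => `|k x|%:E).
  move: bk H; case: (ess_sup _ _) => [r _ H|//|_ H].
    by exists r; apply: aeS H => x; rewrite lee_fin.
  (* An essential supremum [-oo] means that the measure is zero, and then any bound will do. *)
  by exists 0; apply: aeS H => x; rewrite leeNy_eq.
have [M kM] := bk; apply: (@le_lt_trans _ _ M%:E); last exact: ltry.
by apply/ess_supP; apply: aeS kM => x; rewrite lee_fin.
Qed.

Lemma Linfty_bounded k M :
  measurable_fun (D : set (borel_rV R d)) (k : borel_rV R d -> R) ->
  (forall x, D x -> `|k x| <= M) -> Linfty oD k.
Proof. by move=> mk kM; apply/LinftyP; split => //; exists M; exact: ae_on. Qed.

Lemma Linfty_cst c : Linfty oD (fun=> c).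
Proof.
by apply: (@Linfty_bounded _ `|c|) => //; exact: measurable_cst.
Qed.

Lemma Linfty_lin c k l : Linfty oD k -> Linfty oD l ->
  Linfty oD (fun x => c * k x + l x).
Proof.
move=> /LinftyP[mk [M kM]] /LinftyP[ml [M' lM']]; apply/LinftyP; split.
  apply: measurable_funD => //; apply: measurable_funM => //.
exists (`|c| * M + M'); apply: aeS2 kM lM' => x kx lx.
by rewrite (le_trans (ler_normD _ _))// lerD// normrM ler_wpM2l.
Qed.

Lemma LinftyB k l : Linfty oD k -> Linfty oD l ->
  Linfty oD (fun x => k x - l x).
Proof.
move=> Lk Ll; have := Linfty_lin (-1) _ _ Ll Lk.
by congr (Linfty _ _); apply/funext => x; rewrite mulN1r addrC.
Qed.

Lemma Linfty_norm k : Linfty oD k -> Linfty oD (fun x => `|k x|).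
Proof.
move=> /LinftyP[mk [M kM]]; apply/LinftyP; split.
  by apply: measurableT_comp => //; exact: normr_measurable.
by exists M; apply: aeS kM => x; rewrite normr_id.
Qed.

Lemma Linfty_sum J (c : nat -> R) (k : nat -> 'rV[R]_d -> R) :
  (forall j, Linfty oD (k j)) -> Linfty oD (fun x => \sum_(j < J) c j * k j x).
Proof.
move=> Lk; elim: J => [|J IHJ].
  by under eq_fun do rewrite big_ord0; exact: Linfty_cst.
have := Linfty_lin (c J) _ _ (Lk J) IHJ.
by congr (Linfty _ _); apply/funext => x; rewrite big_ord_recr /= addrC.
Qed.

End Linfty_theory.

(** * Dependence of [a1] on its coefficient *)

Section form_a1_theory.
Context {R : realType} {d : nat} {D : set 'rV[R]_d} (oD : open D).
Context {V Q : completeNormedModType R}.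
Variables (b : {bilinear V -> Q -> R | *%R & *%R}).
Variable a1 : V -> V -> ('rV[R]_d -> R) -> R.
Variables (c1 C1 : R).
Hypothesis C1_gt0 : 0 < C1.
Hypothesis a1P : form_a1_assumptions oD b a1 c1 C1.
Implicit Types k l : 'rV[R]_d -> R.

Lemma a1_lforml k v : Linfty oD k -> lform (fun w => a1 w v k).
Proof. by move=> Lk c w w'; exact: (a1_linearl a1P). Qed.

Lemma a1_lformr k w : Linfty oD k -> lform (fun v => a1 w v k).
Proof. by move=> Lk c v v'; exact: (a1_linearr a1P). Qed.

Lemma a1_le k M w v : Linfty oD k -> 0 <= M ->
  (\forall x \ae lebesgue_on oD, `|k x| <= M) ->
  `|a1 w v k| <= C1 * M * `|w| * `|v|.
Proof.
move=> Lk M0 kM.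
have bnd w' : a1 w' v k <= C1 * M * `|w'| * `|v|.
  rewrite -lee_fin (le_trans (a1_bounded a1P Lk w' v))//.
  rewrite -mulrA [leRHS]EFinM lee_wpmul2r ?lee_fin ?mulr_ge0// EFinM lee_wpmul2l//.
    by rewrite lee_fin ltW.
  by apply/ess_supP; apply: aeS kM => x; rewrite lee_fin.
rewrite ler_norml bnd andbT lerNl -(lformN _ (a1_lforml _ v Lk)).
by have := bnd (- w); rewrite normrN.
Qed.

Lemma a1_cst0 w v : a1 w v (fun=> 0) = 0.
Proof.
apply/eqP; rewrite -normr_le0.
have := a1_le _ 0 w v (Linfty_cst oD 0) (lexx _).
rewrite mulr0 !mul0r; apply; apply: ae_on => x _; by rewrite normr0.
Qed.

Lemma a1B k l w v : Linfty oD k -> Linfty oD l ->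
  a1 w v (fun x => k x - l x) = a1 w v k - a1 w v l.
Proof.
move=> Lk Ll; rewrite addrC -mulN1r -(a1_linear_coef a1P)//.
by congr (a1 _ _ _); apply/funext => x; rewrite mulN1r addrC.
Qed.

(** [a1] takes functions, not classes; its bound by the essential supremum of |k - l| makes it
    depend on the class only. *)
Lemma a1_ae_eq k l w v : Linfty oD k -> Linfty oD l ->
  (\forall x \ae lebesgue_on oD, k x = l x) -> a1 w v k = a1 w v l.
Proof.
move=> Lk Ll kl; apply/eqP; rewrite -subr_eq0 -a1B// -normr_le0.
have := a1_le _ 0 w v (LinftyB oD _ _ Lk Ll) (lexx _).
rewrite mulr0 !mul0r; apply; apply: aeS kl => x ->.
by rewrite subrr normr0.
Qed.

(* [a1_coercive] only controls the kernel of [b]; on all of [V] monotonicity comes from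
   [a1_young] applied to k - l and w = v. *)
Lemma a1_mono k l v : Linfty oD k -> Linfty oD l ->
  (\forall x \ae lebesgue_on oD, k x <= l x) -> a1 v v k <= a1 v v l.
Proof.
move=> Lk Ll kl; have Lkl := LinftyB oD _ _ Lk Ll.
have := a1_young a1P Lkl v v.
rewrite (a1_ae_eq (fun x => `|k x - l x|) (fun x => l x - k x)).
- rewrite !a1B//; lra.
- exact: Linfty_norm.
- exact: LinftyB.
by apply: aeS kl => x kl; rewrite distrC ger0_norm// subr_ge0.
Qed.

Lemma a1_ge0 k v : Linfty oD k -> (\forall x \ae lebesgue_on oD, 0 <= k x) ->
  0 <= a1 v v k.
Proof.
by move=> Lk k0; rewrite -(a1_cst0 v v); apply: a1_mono => //; exact: Linfty_cst.
Qed.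

Lemma a1_sum J (c : nat -> R) (k : nat -> 'rV[R]_d -> R) w v :
  (forall j, Linfty oD (k j)) ->
  a1 w v (fun x => \sum_(j < J) c j * k j x) = \sum_(j < J) c j * a1 w v (k j).
Proof.
move=> Lk; elim: J => [|J IHJ].
  by under eq_fun do rewrite big_ord0; rewrite big_ord0 a1_cst0.
rewrite big_ord_recr /= -IHJ addrC -(a1_linear_coef a1P)//; last exact: Linfty_sum.
by congr (a1 _ _ _); apply/funext => x; rewrite big_ord_recr /= addrC.
Qed.

End form_a1_theory.

(** The inf-sup condition in the dual form used for stability; q = 0, which the infimum leaves out,
    is trivial. *)
Lemma inf_sup_le {R : realType} {V Q : completeNormedModType R}
    (b : {bilinear V -> Q -> R | *%R & *%R}) (beta : R) :
  (beta%:E <= ereal_inf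
    [set ereal_sup [set (b v q / (`|v| * `|q|))%:E | v in [set v : V | v != 0%R]]
      | q in [set q : Q | q != 0%R]])%E ->
  forall q c, 0 <= c -> (forall v, b v q <= c * `|v|) -> beta * `|q| <= c.
Proof.
move=> infsup q c c0 bc; have [->|q0] := eqVneq q 0; first by rewrite normr0 mulr0.
have nq : 0 < `|q| by rewrite normr_gt0.
rewrite -ler_pdivlMr// -lee_fin (le_trans infsup)//.
apply: (@le_trans _ _ (ereal_sup
    [set (b v q / (`|v| * `|q|))%:E | v in [set v : V | v != 0%R]])).
  by apply: ereal_inf_lbound; exists q.
apply: ge_ereal_sup => _ [v /= v0 <-]; rewrite lee_fin invfM mulrA.
by rewrite ler_wpM2r ?invr_ge0// ler_pdivrMr// normr_gt0.
Qed.

(** * Affine coefficients *)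

Section affine_theory.
Context {R : realType} {d : nat} {D : set 'rV[R]_d}.
Variable k : nat -> 'rV[R]_d -> R.

Lemma cvgn_finite_series (c : nat -> R) J : (forall j, (J <= j)%N -> c j = 0) ->
  series c n @[n --> \oo] --> \sum_(j < J) c j.
Proof.
move=> c0; apply: cvg_near_cst; exists J => // n /= Jn.
rewrite /series /= big_mkord (bigID (fun j : 'I_n => (j < J)%N)) /=.
rewrite -(big_ord_widen _ c Jn) [X in _ + X]big1 ?addr0// => j.
by rewrite -leqNgt; exact: c0.
Qed.

Lemma affine_finite (y : nat -> R) J x : (forall j, (J <= j)%N -> y j = 0) ->
  affine k y x = k 0 x + \sum_(j < J) y j * k j.+1 x.
Proof.
move=> y0; rewrite /affine; congr (_ + _).
apply: (cvg_lim (@norm_hausdorff _ _)); apply: cvgn_finite_series => j Jj.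
by rewrite y0// mul0r.
Qed.

Lemma affine0 x : affine k (fun=> 0) x = k 0 x.
Proof. by rewrite (@affine_finite _ 0)// big_ord0 addr0. Qed.

Hypothesis k_cvg : affine_converges D k.

(** The two series differ by a series with at most one nonzero term. *)
Lemma affine_upd (y : nat -> R) j h x : D x -> cube y ->
  cube [eta y with j |-> h] ->
  affine k [eta y with j |-> h] x = affine k y x + (h - y j) * k j.+1 x.
Proof.
move=> Dx yC yC'; rewrite /affine -addrA; congr (_ + _).
apply: (cvg_lim (@norm_hausdorff _ _)).
have fin : series (fun i => if i == j then (h - y j) * k j.+1 x else 0) n
    @[n --> \oo] --> (h - y j) * k j.+1 x.
  have := @cvgn_finite_series
    (fun i => if i == j then (h - y j) * k j.+1 x else 0) j.+1.
  rewrite big_ord_recr /= eqxx big1 ?add0r; last first.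
    by move=> i _; rewrite ltn_eqF.
  apply => i ji; case: eqP => // ij; by rewrite ij ltnn in ji.
have yk : series (fun i => y i * k i.+1 x) n @[n --> \oo] -->
    limn (series (fun i => y i * k i.+1 x)) by exact: k_cvg.
apply: cvg_trans (cvgD yk fin); apply: near_eq_cvg; near=> n.
rewrite fctE /series /= -big_split /=; apply: eq_bigr => i _.
by case: eqP => [->|_]; rewrite ?addr0// -mulrDl addrC subrK.
Unshelve. all: by end_near. Qed.

Lemma affine_remainder_le (y : nat -> R) J x e : D x -> cube y ->
  (forall n, \sum_(j < n | (J <= j)%N) `|k j.+1 x| <= e) ->
  `|affine k y x - k 0 x - \sum_(j < J) y j * k j.+1 x| <= e.
Proof.
move=> Dx yC ke; rewrite /affine [_ + limn _]addrC addrK.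
set s := series _; set S := \sum_(j < J) _.
have sS : `|s n - S| @[n --> \oo] --> `|limn s - S|.
  by apply: cvg_norm; apply: cvgB; [exact: k_cvg|exact: cvg_cst].
apply: cvgr_to_le sS _.
exists J => // n /= Jn; apply: le_trans (ke n).
rewrite /s /series /= big_mkord (bigID (fun j : 'I_n => (j < J)%N)) /=.
rewrite /S (big_ord_widen _ (fun j => y j * k j.+1 x) Jn) addrAC subrr add0r.
rewrite (le_trans (ler_norm_sum _ _ _))//.
rewrite [leLHS](eq_bigl (fun j : 'I_n => (J <= j)%N)) => [|j]; last by rewrite -leqNgt.
apply: ler_sum => j _; rewrite normrM ler_piMl//.
by rewrite ler_norml yC.
Qed.

Lemma affine_gt (eps : R) x (y : nat -> R) : (eps%:E < affine_min D k)%E ->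
  D x -> cube y -> eps < affine k y x.
Proof.
move=> eps_lt Dx yC; rewrite -lte_fin (lt_le_trans eps_lt)//.
by apply: ereal_inf_lbound; exists x => //; exists y.
Qed.

Lemma affine_lt (M : R) x (y : nat -> R) : (affine_max D k < M%:E)%E ->
  D x -> cube y -> affine k y x < M.
Proof.
move=> lt_M Dx yC; rewrite -lte_fin (le_lt_trans _ lt_M)//.
by apply: ereal_sup_ubound; exists x => //; exists y.
Qed.

(* Take y_j = - sg kappa_j(x) for j < J and y_j = 0 otherwise. *)
Lemma sum_abs_le (eps : R) x J : (eps%:E < affine_min D k)%E -> D x ->
  \sum_(j < J) `|k j.+1 x| <= k 0 x - eps.
Proof.
move=> eps_lt Dx; pose y j := if (j < J)%N then - Num.sg (k j.+1 x) else 0.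
have yC : cube y.
  move=> j; rewrite /y; case: ifP => _; last by rewrite oppr_le0 ler01.
  by rewrite -ler_norml normrN normr_sg; case: (_ != 0); rewrite ?lexx ?ler01.
have := affine_gt _ _ _ eps_lt Dx yC.
rewrite (@affine_finite _ J); last by move=> j; rewrite /y ltnNge => ->.
have -> : \sum_(j < J) y j * k j.+1 x = - \sum_(j < J) `|k j.+1 x|.
  by rewrite -sumrN; apply: eq_bigr => j _; rewrite /y ltn_ord mulNr normrEsg.
lra.
Qed.

(** Measurability passes to the pointwise limit of the partial sums, and boundedness is read off the
    range. *)
Lemma affine_Linfty (oD : open D) (theta Theta : R) (y : nat -> R) :
  (forall j, Linfty oD (k j)) -> cube y ->
  (forall x, D x -> theta <= affine k y x <= Theta) -> 0 <= theta ->
  Linfty oD (affine k y).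
Proof.
move=> Lk yC ky th0; apply: (@Linfty_bounded _ _ _ _ _ Theta) => [|x Dx]; last first.
  by have /andP[h1 h2] := ky x Dx; rewrite ger0_norm// (le_trans th0).
apply: (@measurable_fun_cvg _ (borel_rV R d) R _
    (fun n x => k 0 x + \sum_(j < n) y j * k j.+1 x)).
  move=> n; apply: measurable_funD; first by have [] := Lk 0%N.
  by have [] := Linfty_sum oD n y (fun j => k j.+1) (fun j => Lk j.+1).
move=> x Dx; apply: cvgD; first exact: cvg_cst.
have yk : series (fun i => y i * k i.+1 x) n @[n --> \oo] -->
    limn (series (fun i => y i * k i.+1 x)) by exact: k_cvg.
apply: cvg_trans yk; apply: near_eq_cvg; near=> n.
by rewrite /series /= big_mkord.
Unshelve. all: by end_near. Qed.

End affine_theory.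

Lemma infinite_multi_index : infinite_set [set: multi_index].
Proof.
move=> fin; have [J [n sub]] := fsub_mbox (fset_set [set: multi_index]).
pose nu : multi_index := [fsfun ([fsfun] : multi_index) with 0%N |-> n.+1].
have nuT : nu \in fset_set [set: multi_index] by rewrite in_fset_set// inE.
have /mem_mbox/(_ 0%N) := fsubsetP sub nu nuT.
by rewrite fsfun_with; case: ifP => //; rewrite ltnn.
Qed.

(** * The estimates *)

Section taylor_estimates.
Context {R : realType} {W : normedModType R}.
Implicit Types (psi : (nat -> R) -> W) (nu : multi_index).

(** More than C / e^2 coefficients of norm at least e would break the bound on the sums of squares,
    so only finitely many exceed a given level. *)
Lemma largest_coefs_exist psi :
  bounded_sums (fun nu => `|taylor_coef psi nu| ^+ 2) ->
  exists Lambda : nat -> {fset multi_index},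
    forall N, largest_coefs N psi (Lambda N).
Proof.
move=> [C tC].
suff largest N : exists L, largest_coefs N psi L.
  by have [Lambda LambdaP] := choice largest; exists Lambda.
apply: (largest_exists (fun nu => `|taylor_coef psi nu|)) => //.
  exact: infinite_multi_index.
move=> e e0; apply: contrapT => inf.
have e2 : 0 < e ^+ 2 by rewrite exprn_gt0.
have [B Be NB] := infinite_set_fset (Num.truncn (C / e ^+ 2)).+1 inf.
have : #|` B|%:R * e ^+ 2 <= C.
  apply: le_trans (tC B); rewrite mulr_natl.
  have -> : e ^+ 2 *+ #|` B| = \sum_(nu <- B) e ^+ 2.
    by rewrite big_const_seq count_predT iter_addr_0.
  rewrite big_seq [leRHS]big_seq; apply: ler_sum => nu /Be /= te.
  by rewrite ler_sqr ?nnegrE// ltW.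
rewrite -ler_pdivlMr// leNgt => /negP; apply.
by rewrite (lt_le_trans (truncnS_gt _))// ler_nat.
Qed.

(** The error is compared with a finite Taylor sum over some L containing [Lambda N]: the part over
    the difference of the two sets is bounded by [stechkin] independently of L, and the rest is at
    most an arbitrary e. *)
Lemma taylor_estimate_of_approximation psi (Lambda : nat -> {fset multi_index})
    (s : R) : 0 < s < 1 ->
  bounded_sums (fun nu => `|taylor_coef psi nu| `^ s) ->
  (forall N, largest_coefs N psi (Lambda N)) ->
  (forall y, cube y -> forall (e : R) (L0 : {fset multi_index}), 0 < e ->
    exists2 L : {fset multi_index}, (L0 `<=` L)%fset &
      `|psi y - taylor_sum L psi y| <= e) ->
  taylor_estimate psi Lambda s.
Proof.
move=> s01 [C tC] large approx; have /andP[s0 s1] := s01.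
have tell : in_ell s (fun nu => `|taylor_coef psi nu|).
  apply/in_ellP => //; exists C => L.
  by under eq_bigr do rewrite normr_id.
split => // N N0; have [S [S0 -> tS]] := lnormE _ _ s0 tell.
rewrite -EFinM; apply: ge_ereal_sup => _ [y yC <-]; rewrite lee_fin.
have [LN LF] := large N.
apply/ler_addgt0Pl => e e0; have [L LL psiL] := approx y yC e (Lambda N) e0.
have -> : psi y - taylor_sum (Lambda N) psi y = (psi y - taylor_sum L psi y) +
    \sum_(nu <- (L `\` Lambda N)%fset) multi_pow y nu *: taylor_coef psi nu.
  by rewrite /taylor_sum (sum_fsetD _ _ _ _ _ LL) opprD addrA subrK.
rewrite (le_trans (ler_normD _ _))// lerD//.
apply: (@le_trans _ _
    (\sum_(nu <- (L `\` Lambda N)%fset) `|taylor_coef psi nu|)).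
  rewrite (le_trans (ler_norm_sum _ _ _))//; apply: ler_sum => nu _.
  by rewrite normrZ ler_piMl// multi_pow_le1.
apply: (stechkin _ _ _ _ (Lambda N)) => //.
  by move=> L'; have := tS L'; under eq_bigr do rewrite normr_id.
by move=> nu; rewrite !inE => /andP[].
Qed.

End taylor_estimates.

(** * The parametric saddle point problem *)

Section parametric_saddle_point.
Context {R : realType} {d : nat} {D : set 'rV[R]_d} (oD : open D).
Hypothesis D_nonempty : D !=set0.
Context {V Q K : completeNormedModType R}.
Context {ev : K -> 'rV[R]_d -> R}.
Hypothesis K_space : function_space oD ev.
Variables (f : {scalar V}) (g : {scalar Q}).
Variables (b : {bilinear V -> Q -> R | *%R & *%R}) (a0 : {biscalar V}).
Variable a1 : V -> V -> ('rV[R]_d -> R) -> R.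
Context {c1 C1 : R}.
Hypothesis C1_gt0 : 0 < C1.
Hypothesis a1P : form_a1_assumptions oD b a1 c1 C1.
Context {theta Theta gamma delta alpha beta : R}.
Hypothesis theta_gt0 : 0 < theta.
Hypothesis theta_lt : theta < Theta.
Hypothesis gamma_gt0 : 0 < gamma.
Hypothesis alpha_gt0 : 0 < alpha.
Hypothesis beta_gt0 : 0 < beta.
Hypothesis wp : well_posedness oD b a0 a1 theta Theta gamma delta alpha beta.
Variable kappa : nat -> K.
Let k j := ev (kappa j).
Hypothesis k_cvg : affine_converges D k.
Hypothesis k_min : (theta%:E < affine_min D k)%E.
Hypothesis k_max : (affine_max D k < (Theta / 2)%:E)%E.
Variables (u : (nat -> R) -> V) (p : (nat -> R) -> Q).
Hypothesis up_sol : forall y, cube y ->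
  saddle_point_solution b a0 a1 f g (affine k y) (u y) (p y).

Let A (y : nat -> R) w v := form_a a0 a1 w v (affine k y).
Let B j w v := a1 w v (k j.+1).
Let N j v := a1 v v (fun x => `|k j.+1 x|).
Let Cs := alpha^-1 + (1 + gamma / alpha) / beta.
Let M := C1 * Theta.
Let t := taylor_coef u.
Let tp := taylor_coef p.

Let Theta_gt0 : 0 < Theta. Proof. exact: lt_trans theta_lt. Qed.
Let M_gt0 : 0 < M. Proof. exact: mulr_gt0. Qed.
Let cube0 : (cube : set (nat -> R)) (fun=> 0).
Proof. exact/ocube_cube/ocube0. Qed.

Let Lk j : Linfty oD (k j). Proof. exact: (function_space_Linfty K_space). Qed.

Let range y x : cube y -> D x -> theta <= affine k y x <= Theta.
Proof.
move=> yC Dx; rewrite ltW ?(affine_gt _ _ _ _ k_min)//=.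
have := Theta_gt0; have := affine_lt _ _ _ _ k_max Dx yC; lra.
Qed.

Let LA y : cube y -> Linfty oD (affine k y).
Proof.
move=> yC; apply: (affine_Linfty _ k_cvg oD theta Theta) => //.
  by move=> x; exact: range.
exact: ltW.
Qed.

Let k0_range x : D x -> theta <= k 0 x <= Theta.
Proof. by move=> Dx; rewrite -(affine0 k); exact: range. Qed.

(** [sum_abs_le] at eps = theta bounds each |kappa_j| by kappa_0 - theta. *)
Let k_le j x : D x -> `|k j.+1 x| <= Theta.
Proof.
move=> Dx; have := sum_abs_le k theta x j.+1 k_min Dx.
have /andP[_ k0] := k0_range _ Dx; rewrite big_ord_recr /=.
have : 0 <= \sum_(i < j) `|k i.+1 x| by exact: sumr_ge0.
move=> S0 h; apply: le_trans k0; have := theta_gt0; move: S0 h.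
move: (\sum_(i < j) _) (k 0 x) => S z; lra.
Qed.

Let b_linl q : lform (b ^~ q).
Proof. by move=> c v v'; rewrite (linearPl b). Qed.

Let b_linr v : lform (b v).
Proof. by move=> c q q'; rewrite (linearPr b). Qed.

Let A_linl y : cube y -> forall v, lform (A y ^~ v).
Proof.
move=> yC v c w w'; rewrite /A /form_a (linearPl a0).
by rewrite (a1_linearl a1P (LA _ yC)) /=; ring.
Qed.

Let A_bnd y : cube y -> forall w v, A y w v <= gamma * `|w| * `|v|.
Proof.
move=> yC w v; apply: (form_a_bounded wp); first exact: LA.
by move=> x; exact: range.
Qed.

Let B_linl j v : lform (B j ^~ v).
Proof. exact: (a1_lforml _ _ _ _ _ a1P). Qed.

Let B_linr j w : lform (B j w).
Proof. exact: (a1_lformr _ _ _ _ _ a1P). Qed.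

Let B_bnd j w v : `|B j w v| <= M * `|w| * `|v|.
Proof.
apply: (a1_le _ _ _ _ _ C1_gt0 a1P) => //; first exact: ltW.
by apply: ae_on => x; exact: k_le.
Qed.

Let A_upd y j h : cube y -> cube [eta y with j |-> h] ->
  forall w v, A [eta y with j |-> h] w v = A y w v + (h - y j) * B j w v.
Proof.
move=> yC yC' w v; rewrite /A /form_a -addrA; congr (_ + _).
rewrite (a1_ae_eq _ _ _ _ _ C1_gt0 a1P _
    (fun x => (h - y j) * k j.+1 x + affine k y x)).
- by rewrite (a1_linear_coef a1P (Lk j.+1) (LA _ yC)) addrC.
- exact: LA.
- by apply: Linfty_lin => //; exact: LA.
by apply: ae_on => x Dx; rewrite (affine_upd _ k_cvg)// addrC.
Qed.

Let Cs_ge0 : 0 <= Cs.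
Proof.
by rewrite addr_ge0 ?invr_ge0 ?divr_ge0 ?addr_ge0 ?divr_ge0// ltW.
Qed.

Let infsup : forall q c, 0 <= c -> (forall v, b v q <= c * `|v|) ->
  beta * `|q| <= c.
Proof. exact: inf_sup_le (form_b_inf_sup wp). Qed.

Let stab y : cube y -> forall w r c, 0 <= c -> (forall q, b w q = 0) ->
  (forall v, A y w v + b v r <= c * `|v|) -> `|w| <= Cs * c /\ `|r| <= Cs * c.
Proof.
move=> yC; apply: saddle_stability => //.
- exact: ltW.
- exact: A_linl.
- exact: A_bnd.
- move=> v vK; apply: (form_a_coercive wp) => //; first exact: LA.
  by move=> x; exact: range.
Qed.

Let recursion nu :
  (forall v, A (fun=> 0) (t nu) v + b v (tp nu) =
    (if nu == [fsfun] then f v else 0) -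
    \sum_(j <- finsupp nu) B j (t (mdec nu j)) v) /\
  (forall q, b (t nu) q = if nu == [fsfun] then g q else 0).
Proof.
apply: (@taylor_recursion _ _ _ A B b f g gamma delta M Cs) => //.
- by move=> j w v; rewrite (le_trans (ler_norm _)).
- exact: (form_b_bounded wp).
- exact: ltW.
Qed.

Let young j w v : - B j w v <= 2^-1 * (N j w + N j v).
Proof.
rewrite -(lformN _ (B_linl j v)) (le_trans (a1_young a1P (Lk _) _ _))//.
rewrite (lformN _ (a1_lforml _ _ _ _ _ a1P _ _ (Linfty_norm _ _ (Lk j.+1)))).
rewrite (lformN _ (a1_lformr _ _ _ _ _ a1P _ _ (Linfty_norm _ _ (Lk j.+1)))).
by rewrite opprK.
Qed.

(** The constant coefficient eps is admissible, as theta < eps < kappa_0 <= Theta, so [a] at eps is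
    coercive on the kernel with the same alpha. *)
Let A0_coer eps v : theta < eps -> (eps%:E < affine_min D k)%E ->
  (forall q, b v q = 0) ->
  alpha * `|v| ^+ 2 + a1 v v (fun x => k 0 x - eps) <= A (fun=> 0) v v.
Proof.
move=> eps_gt eps_lt vK.
have -> : A (fun=> 0) v v =
    form_a a0 a1 v v (fun=> eps) + a1 v v (fun x => k 0 x - eps).
  rewrite /A; have -> : affine k (fun=> 0) = k 0 by apply/funext => x; exact: affine0.
  rewrite (a1B _ _ _ _ _ a1P)//; last exact: Linfty_cst.
  by rewrite /form_a; ring.
rewrite lerD2r; apply: (form_a_coercive wp) => //; first exact: Linfty_cst.
move=> x Dx; rewrite ltW//=; have := affine_gt _ _ _ _ eps_lt Dx cube0.
by have := affine_lt _ _ _ _ k_max Dx cube0; have := Theta_gt0; lra.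
Qed.

Let Eu := energy_bound t alpha M.
Let Ep := energy_bound_p t tp alpha beta gamma M.

(** [Eu] and [Ep] involve neither [rho] nor [eps]. Admissibility is asked almost everywhere because
    in (i) the norms of the kappa_j control these functions only essentially. *)
Lemma weighted_coef_sums (eps : R) (rho : nat -> R) :
  theta < eps -> (eps%:E < affine_min D k)%E -> (forall j, 0 <= rho j) ->
  (\forall x \ae lebesgue_on oD, forall J,
    \sum_(j < J) rho j * `|k j.+1 x| <= k 0 x - eps) ->
  (forall L : {fset multi_index},
    \sum_(nu <- L) (multi_pow rho nu * `|taylor_coef u nu|) ^+ 2 <= Eu) /\
  (forall L : {fset multi_index},
    \sum_(nu <- L) (multi_pow rho nu * `|taylor_coef p nu|) ^+ 2 <= Ep).
Proof.
move=> eps_gt eps_lt rho0 rho_adm.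
have Leps : Linfty oD (fun x => k 0 x - eps).
  by apply: LinftyB => //; exact: Linfty_cst.
have LN j : Linfty oD (fun x => `|k j.+1 x|) by exact: Linfty_norm.
pose dd v := a1 v v (fun x => k 0 x - eps).
have N_ge0 j v : 0 <= N j v.
  by apply: (a1_ge0 _ _ _ _ _ C1_gt0 a1P) => //; exact: ae_on.
have dd_bnd v : dd v <= M * `|v| ^+ 2.
  rewrite (le_trans (ler_norm _))// expr2 mulrA.
  apply: (a1_le _ _ _ _ _ C1_gt0 a1P) => //; first exact: ltW.
  apply: ae_on => x Dx; have := affine_gt _ _ _ _ eps_lt Dx cube0.
  rewrite affine0 => k0eps; have /andP[_ k0T] := k0_range _ Dx.
  rewrite ger0_norm ?subr_ge0 ?ltW//.
  by rewrite ltrBlDr (le_lt_trans k0T)// ltrDl (lt_trans theta_gt0).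
have adm J v : \sum_(j < J) rho j * N j v <= dd v.
  have := a1_sum _ _ _ _ _ C1_gt0 a1P J rho (fun j x => `|k j.+1 x|) v v LN.
  rewrite /N => <-; apply: (a1_mono _ _ _ _ _ C1_gt0 a1P) => //.
    exact: (Linfty_sum oD J rho (fun j x => `|k j.+1 x|)).
  by apply: aeS rho_adm => x; exact.
have rec nu := proj1 (recursion nu); have rec_div nu := proj2 (recursion nu).
have A0_lin := A_linl _ cube0.
split; apply: sum_mbox_le => [nu|J n]; rewrite ?sqr_ge0//.
  apply: (@taylor_energy _ _ _ (A (fun=> 0)) B b f g t tp alpha M N dd) => //.
  by move=> v; exact: A0_coer.
apply: (@taylor_energy_p _ _ _ (A (fun=> 0)) B b f g t tp alpha beta gamma M N dd) => //.
- exact: ltW.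
- exact: ltW.
- exact: A_bnd.
by move=> v; exact: A0_coer.
Qed.

(** The remainder form is [a1] at the tail of the coefficient series, so uniformly small tails make
    it small. Stability yields p along with u, from the summability of the coefficients of u. *)
Lemma taylor_series_approximates :
  (forall e, 0 < e -> exists J0, \forall x \ae lebesgue_on oD,
    forall n, \sum_(j < n | (J0 <= j)%N) `|k j.+1 x| <= e) ->
  bounded_sums (fun nu => `|taylor_coef u nu|) ->
  forall y, cube y -> forall (e : R) (L0 : {fset multi_index}), 0 < e ->
  exists L : {fset multi_index}, [/\ (L0 `<=` L)%fset,
    `|u y - taylor_sum L u y| <= e & `|p y - taylor_sum L p y| <= e].
Proof.
move=> tails t_sum y yC e L0 e0.
have rec nu := proj1 (recursion nu); have rec_div nu := proj2 (recursion nu).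
pose r J x := affine k y x - k 0 x - \sum_(j < J) y j * k j.+1 x.
have LS J : Linfty oD (fun x => \sum_(j < J) y j * k j.+1 x).
  exact: (Linfty_sum oD J y (fun j => k j.+1)).
have LAk : Linfty oD (fun x => affine k y x - k 0 x).
  by apply: LinftyB => //; exact: LA.
have Lr J : Linfty oD (r J) by exact: LinftyB.
have [uy gy] := up_sol _ yC.
apply: (@taylor_convergence _ _ _ (A (fun=> 0)) (A y) B b
  (fun J w v => a1 w v (r J)) y f g t tp M Cs (u y) (p y)) => //.
- exact: A_linl.
- exact: A_linl.
- exact: ltW.
- move=> J w v; rewrite (a1B _ _ _ _ _ a1P)// (a1B _ _ _ _ _ a1P _ _ _ _ (LA _ yC) (Lk 0)).
  rewrite (a1_sum _ _ _ _ _ C1_gt0 a1P J y (fun j => k j.+1))//.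
  have -> : A (fun=> 0) w v = a0 w v + a1 w v (k 0).
    by rewrite /A /form_a; congr (_ + a1 _ _ _); apply/funext => x; exact: affine0.
  by rewrite /A /form_a -/(B _ _ _); ring.
- move=> e' e'0; have [J0 J0P] := tails _ (divr_gt0 e'0 C1_gt0).
  exists J0 => J J0J w v.
  have -> : e' = C1 * (e' / C1) by rewrite mulrC divfK// gt_eqF.
  apply: (a1_le _ _ _ _ _ C1_gt0 a1P) => //; first by rewrite divr_ge0// ltW.
  have aeD : \forall x \ae lebesgue_on oD, D x by exact: ae_on.
  apply: (aeS2 _ _ _ _ _ aeD J0P) => x Dx J0x.
  apply: (affine_remainder_le _ k_cvg) => // n; apply: le_trans (J0x n).
  rewrite [leLHS]big_mkcond [leRHS]big_mkcond /=; apply: ler_sum => j _.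
  by case: ifP => [/(leq_trans J0J) -> //|_]; case: ifP.
- exact: stab.
Qed.

(** A point of [D] keeps [affine_min] below +oo, so a midpoint between it and theta makes sense. *)
Let eps_exists : exists2 eps, theta < eps & (eps%:E < affine_min D k)%E.
Proof.
have [x Dx] := D_nonempty.
have : (affine_min D k <= (affine k (fun=> 0%R) x)%:E)%E.
  by apply: ereal_inf_lbound; exists x => //; exists (fun=> 0).
move: k_min; case: (affine_min D k) => [r||]//; rewrite lte_fin => thr _.
by exists ((theta + r) / 2); rewrite ?lte_fin; lra.
Qed.

Let weighted_le (E : R) (rho : nat -> R) (x : multi_index -> R) :
  (forall j, 0 <= rho j) -> (forall nu, 0 <= x nu) ->
  (forall L : {fset multi_index}, \sum_(nu <- L) (multi_pow rho nu * x nu) ^+ 2 <= E) ->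
  forall nu, multi_pow rho nu * x nu <= Num.sqrt E.
Proof.
move=> rho0 x0 xE nu; have := xE [fset nu]%fset.
rewrite big_seq_fset1 => /ler_wsqrtr; rewrite sqrtr_sqr ger0_norm//.
by rewrite mulr_ge0// multi_pow_ge0.
Qed.

Lemma coef_square_sums :
  bounded_sums (fun nu => `|taylor_coef u nu| ^+ 2) /\
  bounded_sums (fun nu => `|taylor_coef p nu| ^+ 2).
Proof.
have [eps eps_gt eps_lt] := eps_exists.
have pow1 nu : multi_pow (fun=> 1 : R) nu = 1.
  by rewrite /multi_pow big1// => j _; rewrite expr1n.
have [||tu tp'] := weighted_coef_sums eps (fun=> 1) eps_gt eps_lt.
- by move=> _; exact: ler01.
- apply: ae_on => x Dx J; under eq_bigr do rewrite mul1r.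
  exact: sum_abs_le eps_lt Dx.
split; [exists Eu => L; have := tu L|exists Ep => L; have := tp' L].
  by under eq_bigr do rewrite pow1 mul1r.
by under eq_bigr do rewrite pow1 mul1r.
Qed.

Variables Lambda_u Lambda_p : nat -> {fset multi_index}.
Hypothesis large_u : forall n, largest_coefs n u (Lambda_u n).
Hypothesis large_p : forall n, largest_coefs n p (Lambda_p n).

Lemma taylor_estimates_of_kappa (s : R) : 0 < s < 1 ->
  in_ell s (fun j => `|kappa j.+1|) ->
  taylor_estimate u Lambda_u s /\ taylor_estimate p Lambda_p s.
Proof.
move=> s01 kappa_ell; have /andP[s0 s1] := s01.
have s01' : 0 < s <= 1 by rewrite s0 ltW.
have [eps eps_gt eps_lt] := eps_exists.
(* As sum_j |kappa_j| <= kappa_0 - eps, lowering eps to [eps1] frees the margin eps - eps1 for the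
   terms (rho_j - 1) |kappa_j|. *)
pose eps1 := (theta + eps) / 2.
have eps1_gt : theta < eps1 by rewrite /eps1; lra.
have eps1_lt : (eps1%:E < affine_min D k)%E.
  by rewrite (lt_trans _ eps_lt)// lte_fin /eps1; lra.
pose bb j := `|kappa j.+1|.
have bb0 j : 0 <= bb j by rewrite normr_ge0.
have bb_sum : bounded_partial_sums (fun j => bb j `^ s).
  have [C bC] := in_ell_partial_sums _ _ s0 kappa_ell; exists C => J.
  by have := bC J; under eq_bigr do rewrite normr_id.
(* One null set serves all j, since there are countably many of them. *)
have k_bb : \forall x \ae lebesgue_on oD, forall j, `|k j.+1 x| <= bb j.
  apply: ae_foralln => j.
  have /ess_supP := function_space_norm K_space (kappa j.+1).
  by apply: aeS => x; rewrite lee_fin.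
have aeD : \forall x \ae lebesgue_on oD, D x by exact: ae_on.
have adm (rho : nat -> R) : (forall j, 1 <= rho j) ->
    (forall J, \sum_(j < J) (rho j - 1) * bb j <= eps - eps1) ->
    \forall x \ae lebesgue_on oD, forall J,
      \sum_(j < J) rho j * `|k j.+1 x| <= k 0 x - eps1.
  move=> rho1 rhoE; apply: (aeS2 _ _ _ _ _ aeD k_bb) => x Dx kx J.
  have -> : \sum_(j < J) rho j * `|k j.+1 x| =
      \sum_(j < J) `|k j.+1 x| + \sum_(j < J) (rho j - 1) * `|k j.+1 x|.
    by rewrite -big_split /=; apply: eq_bigr => j _; rewrite mulrBl mul1r addrC subrK.
  have : \sum_(j < J) (rho j - 1) * `|k j.+1 x| <= eps - eps1.
    apply: le_trans (rhoE J); apply: ler_sum => j _.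
    by rewrite ler_wpM2l// subr_ge0.
  have := sum_abs_le k eps x J eps_lt Dx; lra.
have eta0 : 0 < eps - eps1 by rewrite /eps1; lra.
have su : bounded_sums (fun nu => `|taylor_coef u nu| `^ s).
  apply: (@summable_of_admissible_weights _ s (eps - eps1) (Num.sqrt Eu) bb) => //.
  move=> rho rho1 rhoE; have rho0 j : 0 <= rho j := le_trans ler01 (rho1 j).
  apply: weighted_le => //.
  by have [] := weighted_coef_sums _ rho eps1_gt eps1_lt rho0 (adm _ rho1 rhoE).
have sp : bounded_sums (fun nu => `|taylor_coef p nu| `^ s).
  apply: (@summable_of_admissible_weights _ s (eps - eps1) (Num.sqrt Ep) bb) => //.
  move=> rho rho1 rhoE; have rho0 j : 0 <= rho j := le_trans ler01 (rho1 j).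
  apply: weighted_le => //.
  by have [] := weighted_coef_sums _ rho eps1_gt eps1_lt rho0 (adm _ rho1 rhoE).
have tails e : 0 < e -> exists J0, \forall x \ae lebesgue_on oD,
    forall n, \sum_(j < n | (J0 <= j)%N) `|k j.+1 x| <= e.
  have b1 := bounded_partial_sums_powR _ _ s01' bb0 bb_sum.
  move=> /(bounded_partial_sums_tail _ bb0 b1)[J0 J0e]; exists J0.
  apply: aeS k_bb => x kx n; apply: le_trans (J0e n).
  by apply: ler_sum => j _.
have su1 := bounded_sums_powR _ _ s01' (fun nu => normr_ge0 _) su.
have approx := taylor_series_approximates tails su1.
split; apply: taylor_estimate_of_approximation => // y yC e L0 e0.
  by have [L [L0L uL _]] := approx y yC e L0 e0; exists L.
by have [L [L0L _ pL]] := approx y yC e L0 e0; exists L.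
Qed.

Lemma taylor_estimates_of_weights (rho : nat -> R) (eps tau : R) :
  (forall j, 1 < rho j) ->
  theta < eps -> (eps%:E < affine_min D k)%E ->
  (forall x, D x ->
    (\sum_(0 <= j <oo) (rho j * `|k j.+1 x|)%:E <= (k 0%N x - eps)%:E)%E) ->
  0 < tau -> in_ell tau (fun j => (rho j)^-1) ->
  let s := 2 * tau / (2 + tau) in
  (s < 1 -> taylor_estimate u Lambda_u s) /\
  (tau < 1 -> taylor_estimate p Lambda_p tau).
Proof.
move=> rho1 eps_gt eps_lt rho_sum tau0 rho_ell s.
have rho_gt0 j : 0 < rho j := lt_trans ltr01 (rho1 j).
have rho0 j : 0 <= rho j := ltW (rho_gt0 j).
have adm x J : D x -> \sum_(j < J) rho j * `|k j.+1 x| <= k 0 x - eps.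
  move=> Dx; rewrite -lee_fin; apply: le_trans (rho_sum x Dx).
  rewrite -sumEFin -(big_mkord xpredT (fun j => (rho j * `|k j.+1 x|)%:E)).
  by apply: nneseries_lim_ge => n _ _; rewrite lee_fin mulr_ge0.
have [wu wp'] := weighted_coef_sums _ rho eps_gt eps_lt rho0
  (ae_on oD _ (fun x Dx J => adm x J Dx)).
have rho_t : bounded_partial_sums (fun j => (rho j)^-1 `^ tau).
  have [C rC] := in_ell_partial_sums _ _ tau0 rho_ell; exists C => J.
  by have := rC J; under eq_bigr do rewrite ger0_norm ?invr_ge0//.
have [_ su] := powR_bounded_sums_of_weighted _ _ _ rho1 tau0 rho_t
  (fun nu => normr_ge0 (taylor_coef u nu)) (ex_intro _ _ wu).
have [sp _] := powR_bounded_sums_of_weighted _ _ _ rho1 tau0 rho_t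
  (fun nu => normr_ge0 (taylor_coef p nu)) (ex_intro _ _ wp').
have tau2 : 0 < 2 + tau by rewrite addr_gt0.
have s0 : 0 < s by rewrite divr_gt0// mulr_gt0.
(* The norms of the kappa_j are not assumed summable here. The tail from J0 on is at most the bound
   on rho_j^(-1) for j >= J0 times sum_j rho_j |kappa_j| <= Theta. *)
have tails e : 0 < e -> exists J0, \forall x \ae lebesgue_on oD,
    forall n, \sum_(j < n | (J0 <= j)%N) `|k j.+1 x| <= e.
  move=> e0; have eT : 0 < e / Theta by rewrite divr_gt0.
  have [J0 J0e] := bounded_partial_sums_tail _ (fun j => powR_ge0 _ _) rho_t
    _ (powR_gt0 tau eT).
  have small j : (J0 <= j)%N -> (rho j)^-1 <= e / Theta.
    move=> J0j; rewrite leNgt; apply/negP => lt_rho.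
    have : (e / Theta) `^ tau < (rho j)^-1 `^ tau.
      by apply: gt0_ltr_powR; rewrite ?nnegrE ?invr_ge0// ltW.
    apply/negP; rewrite -leNgt; apply: le_trans (J0e j.+1).
    rewrite (bigD1 ord_max) //= lerDl sumr_ge0// => i _; exact: powR_ge0.
  exists J0; apply: ae_on => x Dx n.
  apply: (@le_trans _ _ (e / Theta * \sum_(j < n) rho j * `|k j.+1 x|)).
    rewrite mulr_sumr big_mkcond /=; apply: ler_sum => j _; case: ifP => J0j.
      rewrite mulrA ler_peMl//.
      by rewrite -ler_pdivrMr// div1r small.
    apply: mulr_ge0; first exact: ltW.
    by rewrite mulr_ge0.
  have kT : \sum_(j < n) rho j * `|k j.+1 x| <= Theta.
    have /andP[_ k0T] := k0_range _ Dx; have := theta_gt0; have := adm x n Dx.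
    move: k0T eps_gt; move: (\sum_(j < n) _) (k 0 x) => S z; lra.
  by rewrite mulrAC ler_pdivrMr// ler_wpM2l// ltW.
have s_sum : s < 1 -> forall y, cube y ->
    forall (e : R) (L0 : {fset multi_index}), 0 < e ->
    exists L : {fset multi_index}, [/\ (L0 `<=` L)%fset,
    `|u y - taylor_sum L u y| <= e & `|p y - taylor_sum L p y| <= e].
  move=> s1; apply: taylor_series_approximates => //.
  apply: bounded_sums_powR su => [|nu]; last exact: normr_ge0.
  by rewrite s0 ltW.
split=> [s1|tau1]; apply: taylor_estimate_of_approximation => //.
- by rewrite s0.
- move=> y yC e L0 e0.
  by have [L [L0L uL _]] := s_sum s1 y yC e L0 e0; exists L.
- by rewrite tau0.
(* t < 1 forces s < 1, so the coefficients of u are summable, and this is what makes the series for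
   p converge as well. *)
have s1 : s < 1.
  by rewrite ltr_pdivrMr// mul1r; have := tau0; have := tau1; lra.
move=> y yC e L0 e0.
by have [L [L0L _ pL]] := s_sum s1 y yC e L0 e0; exists L.
Qed.

End parametric_saddle_point.

Theorem theorem3p6 (R : realType) (d : nat) (D : set 'rV[R]_d)
    (oD : open D) (D_bounded : bounded_set D) (D_connected : connected D)
    (D_nonempty : D !=set0)
    (V Q K : completeNormedModType R)
    (V_hilbert : hilbert_space V) (Q_hilbert : hilbert_space Q)
    (K_separable : separable K)
    (ev : K -> 'rV[R]_d -> R) (K_space : function_space oD ev)
    (f : {scalar V}) (f_continuous : continuous f)
    (g : {scalar Q}) (g_continuous : continuous g)
    (b : {bilinear V -> Q -> R | *%R & *%R}) (a0 : {biscalar V})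
    (a1 : V -> V -> ('rV[R]_d -> R) -> R)
    (c1 C1 : R) (c1_gt0 : 0 < c1) (C1_gt0 : 0 < C1)
    (a1_assumptions : form_a1_assumptions oD b a1 c1 C1)
    (theta Theta gamma delta alpha beta : R)
    (theta_gt0 : 0 < theta) (theta_lt : theta < Theta)
    (gamma_gt0 : 0 < gamma) (delta_gt0 : 0 < delta)
    (alpha_gt0 : 0 < alpha) (beta_gt0 : 0 < beta)
    (ab_well_posed : well_posedness oD b a0 a1 theta Theta gamma delta alpha beta)
    (kappa : nat -> K)
    (kappa_converges : affine_converges D (fun j => ev (kappa j)))
    (kappa_min_gt : (theta%:E < affine_min D (fun j => ev (kappa j)))%E)
    (kappa_max_lt : (affine_max D (fun j => ev (kappa j)) < (Theta / 2)%:E)%E)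
    (u : (nat -> R) -> V) (p : (nat -> R) -> Q)
    (up_solution : forall y, cube y ->
      saddle_point_solution b a0 a1 f g (affine (fun j => ev (kappa j)) y)
        (u y) (p y)) :
  exists Lambda_u Lambda_p : nat -> {fset multi_index},
  [/\ forall N, (0 < N)%N ->
        largest_coefs N u (Lambda_u N) /\ largest_coefs N p (Lambda_p N),
      forall s : R, 0 < s < 1 ->
        in_ell s (fun j => `|kappa j.+1|) ->
        taylor_estimate u Lambda_u s /\ taylor_estimate p Lambda_p s
    & forall (rho : nat -> R) (eps t : R),
        (forall j, 1 < rho j) ->
        theta < eps -> (eps%:E < affine_min D (fun j => ev (kappa j)))%E ->
        (forall x, D x ->
          (\sum_(0 <= j <oo) (rho j * `|ev (kappa j.+1) x|)%:E
           <= (ev (kappa 0%N) x - eps)%:E)%E) ->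
        0 < t -> in_ell t (fun j => (rho j)^-1) ->
        let s := 2 * t / (2 + t) in
        (s < 1 -> taylor_estimate u Lambda_u s) /\
        (t < 1 -> taylor_estimate p Lambda_p t)].
Proof.
(* Square-summability precedes the hypotheses of (i) and (ii), so the same index sets serve every s,
   rho and t. *)
have [su sp] := coef_square_sums oD D_nonempty K_space f g b a0 a1 C1_gt0
  a1_assumptions theta_gt0 theta_lt gamma_gt0 alpha_gt0 beta_gt0 ab_well_posed
  kappa kappa_converges kappa_min_gt kappa_max_lt u p up_solution.
have [Lu LuP] := largest_coefs_exist _ su.
have [Lp LpP] := largest_coefs_exist _ sp.
exists Lu, Lp; split=> [N _|s|rho eps t]; first by split.
  exact: (taylor_estimates_of_kappa oD D_nonempty K_space f g b a0 a1 C1_gt0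
    a1_assumptions theta_gt0 theta_lt gamma_gt0 alpha_gt0 beta_gt0 ab_well_posed
    kappa kappa_converges kappa_min_gt kappa_max_lt u p up_solution).
exact: (taylor_estimates_of_weights oD K_space f g b a0 a1 C1_gt0
  a1_assumptions theta_gt0 theta_lt gamma_gt0 alpha_gt0 beta_gt0 ab_well_posed
  kappa kappa_converges kappa_min_gt kappa_max_lt u p up_solution).
Qed.
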